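(* Let $\boldsymbol{\alpha}=(\alpha_1,\alpha_2)\in\mathbb{R}^2$ be such that $\{1,\alpha_1,\alpha_2\}$ is a $\mathbb{Q}$-basis for a cubic field $K/\mathbb{Q}$, and let $\Lambda^*$ be the lattice in $K$ dual to $\Lambda=\mathbb{Z}+\alpha_1\mathbb{Z}+\alpha_2\mathbb{Z}$ with respect to the trace form. (1) If $K$ has a nontrivial (non-real) complex embedding, then there is an ellipse $\mathcal{C}_K\subset\mathbb{R}^2$ such that \[\mathcal{A}_{1/2}(\boldsymbol{\alpha})=\bigcup_{s\in \Lambda^*\setminus\{0\}}|\mathrm{N}(s)|^{1/2}\,\mathcal{C}_K.\] (2) If $K$ is totally real, then there is a hyperbola $\mathcal{C}_K^+\subset\mathbb{R}^2$ such that \[\mathcal{A}_{1/2}(\boldsymbol{\alpha})=\bigcup_{s\in \Lambda^*\setminus\{0\}}|\mathrm{N}(s)|^{1/2}\,\ell_{s}(\mathcal{C}_K^+),\] where for each $s\in\Lambda^*\setminus\{0\}$ the map $\ell_s:\mathbb{R}^2\to\mathbb{R}^2$ is either the identity map or a linear map taking $\mathcal{C}_K^+$ to its conjugate hyperbola.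
   Context: For $\boldsymbol{\alpha}\in\mathbb{R}^2$, $\mathcal{A}_{1/2}(\boldsymbol{\alpha})$ is the set of accumulation points in $\mathbb{R}^2$ of $\{|q|^{1/2}(q\boldsymbol{\alpha}-\boldsymbol{p}):q\in\mathbb{Z}\setminus\{0\},\ \boldsymbol{p}\in\mathbb{Z}^2\}$. $\mathrm{N}$ and $\mathrm{Tr}$ are the norm and trace from $K$ to $\mathbb{Q}$; the trace form is $\langle x,y\rangle=\mathrm{Tr}(xy)$, and the dual lattice is $\Lambda^*=\{x\in K:\mathrm{Tr}(xy)\in\mathbb{Z}\ \forall y\in\Lambda\}$ (equivalently, the $\mathbb{Z}$-span of the basis dual to $\{1,\alpha_1,\alpha_2\}$ with respect to the trace form). For a centered hyperbola $\{v\in\mathbb{R}^2: Q(v)=1\}$ with $Q$ an indefinite quadratic form, its conjugate hyperbola is $\{v: Q(v)=-1\}$. Multiplying a set by a positive scalar means homothetic dilation about the origin. *)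

(* Defs.v *)
From HB Require Import structures.
From mathcomp Require Import all_boot all_order all_algebra.
From mathcomp Require Import complex.
From mathcomp Require Import all_classical all_reals topology normedtype.
Set Implicit Arguments. Unset Strict Implicit. Unset Printing Implicit Defensive.
Import Order.TTheory GRing.Theory Num.Theory.
Import numFieldNormedType.Exports.
Local Open Scope ring_scope.
Local Open Scope classical_set_scope.

(* The cubic field K is the Q-span of the basis b = (1, alpha1, alpha2) inside R.
   Elements of K are represented by their rational coordinate row vectors
   x : 'rV[rat]_3 (x = x_0 * 1 + x_1 * alpha1 + x_2 * alpha2).
   The multiplication table m : beta_i * beta_j = \sum_k m i j k * beta_k. *)

Definition basisK (R : realType) (a1 a2 : R) (i : 'I_3) : R :=
  if val i == 0%N then 1 else if val i == 1%N then a1 else a2.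

Definition embR (R : realType) (a1 a2 : R) (x : 'rV[rat]_3) : R :=
  \sum_(i < 3) ratr (x ord0 i) * basisK a1 a2 i.

Definition Kmul (m : 'I_3 -> 'I_3 -> 'I_3 -> rat) (x y : 'rV[rat]_3) : 'rV[rat]_3 :=
  \row_k \sum_(i < 3) \sum_(j < 3) x ord0 i * y ord0 j * m i j k.

Definition Kbasis (l : 'I_3) : 'rV[rat]_3 := delta_mx ord0 l.
Definition Kone : 'rV[rat]_3 := Kbasis ord0.

(* matrix of the Q-linear map (y |-> x * y) on K in the basis b:
   column j holds the coordinates of x * beta_j *)
Definition mulmat (m : 'I_3 -> 'I_3 -> 'I_3 -> rat) (x : 'rV[rat]_3) : 'M[rat]_3 :=
  \matrix_(k, j) \sum_(i < 3) x ord0 i * m i j k.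

Definition Ktr m (x : 'rV[rat]_3) : rat := \tr (mulmat m x).
Definition Knorm m (x : 'rV[rat]_3) : rat := \det (mulmat m x).

Definition dual_lattice m : set 'rV[rat]_3 :=
  [set s | forall l : 'I_3, exists z : int, Ktr m (Kmul m s (Kbasis l)) = z%:~R].

Definition is_cembedding (R : realType) m (sigma : 'rV[rat]_3 -> R[i]) : Prop :=
  [/\ sigma Kone = 1,
      forall x y, sigma (x + y) = sigma x + sigma y &
      forall x y, sigma (Kmul m x y) = sigma x * sigma y].

Definition has_nonreal_embedding (R : realType) m : Prop :=
  exists sigma : 'rV[rat]_3 -> R[i],
    is_cembedding m sigma /\ exists x, sigma x \isn't Num.real.

Definition totally_real (R : realType) m : Prop :=
  forall sigma : 'rV[rat]_3 -> R[i],
    is_cembedding m sigma -> forall x, sigma x \is Num.real.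

Definition approx_points (R : realType) (a1 a2 : R) : set (R * R) :=
  [set v | exists q : int, q != 0 /\ exists p1 p2 : int,
     v = (Num.sqrt `|q%:~R| * (q%:~R * a1 - p1%:~R),
          Num.sqrt `|q%:~R| * (q%:~R * a2 - p2%:~R))].

Definition A_half (R : realType) (a1 a2 : R) : set (R * R) :=
  @limit_point (R * R)%type (approx_points a1 a2).

Definition dilate (R : realType) (r : R) (C : set (R * R)) : set (R * R) :=
  (fun v : R * R => (r * v.1, r * v.2)) @` C.

Definition qform (R : realType) (a b c : R) (v : R * R) : R :=
  a * v.1 ^+ 2 + b * v.1 * v.2 + c * v.2 ^+ 2.

Definition is_ellipse (R : realType) (E : set (R * R)) : Prop :=
  exists a b c x0 y0 : R, 0 < a /\ b ^+ 2 < 4 * a * c /\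
    E = [set v | qform a b c (v.1 - x0, v.2 - y0) = 1].

Definition hyperbola (R : realType) (a b c : R) : set (R * R) :=
  [set v | qform a b c v = 1].
Definition conj_hyperbola (R : realType) (a b c : R) : set (R * R) :=
  [set v | qform a b c v = -1].

Definition is_linear2 (R : realType) (f : R * R -> R * R) : Prop :=
  exists p q r t : R, forall v, f v = (p * v.1 + q * v.2, r * v.1 + t * v.2).

(* Main.v *)
(* Write K (x) R = R x R[j] with j^2 = tau, where tau = -1 if K has a nonreal
   embedding and tau = 1 if K is totally real, and let x in K have components
   e x and Y x + j Z x, so that N x = e x (Y x ^ 2 - tau Z x ^ 2).  As s runs
   through the dual lattice, (q, p) = (Tr s, Tr (s alpha)) runs through Z^3, and
   q alpha - p is the image of (Y s, Z s) under a fixed invertible linear map.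
   Thus the quadratic form Y^2 - tau Z^2, transported to R^2, takes at the point
   |q|^(1/2) (q alpha - p) a value asymptotic to |e s| (Y s ^ 2 - tau Z s ^ 2),
   which is N s up to sign.  Norms on the dual lattice are discrete, so at an
   accumulation point the form is exactly such a signed norm.  Conversely,
   multiplying s by units u with e u -> oo keeps the norm and moves the point
   along its conic by the normalised second component of u; those components are
   dense by Kronecker's theorem, applied to two independent units if tau = 1, and
   to one unit of infinite order together with the period 2 pi if tau = -1. *)

Require Import Defs.
From HB Require Import structures.
From mathcomp Require Import all_boot all_order all_algebra.
From mathcomp Require Import complex.
From mathcomp Require Import all_classical all_reals topology normedtype.
From mathcomp Require Import sequences realfun exp trigo.
From mathcomp Require Import ring lra.
Set Implicit Arguments. Unset Strict Implicit. Unset Printing Implicit Defensive.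
Import Order.TTheory GRing.Theory Num.Theory.
Import numFieldNormedType.Exports.
Local Open Scope ring_scope.
Local Open Scope classical_set_scope.

Local Notation i0 := (@Ordinal 3 0 isT).
Local Notation i1 := (@Ordinal 3 1 isT).
Local Notation i2 := (@Ordinal 3 2 isT).

(** * Case analysis and sums over three indices *)

Lemma forall_ord3 (P : 'I_3 -> Prop) : P i0 -> P i1 -> P i2 -> forall i, P i.
Proof.
move=> P0 P1 P2 [[|[|[|//]]] hi].
- by rewrite (_ : Ordinal hi = i0)//; exact: val_inj.
- by rewrite (_ : Ordinal hi = i1)//; exact: val_inj.
- by rewrite (_ : Ordinal hi = i2)//; exact: val_inj.
Qed.

Lemma sum_ord3 (V : nmodType) (F : 'I_3 -> V) :
  \sum_(i < 3) F i = F i0 + F i1 + F i2.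
Proof.
rewrite !big_ord_recl big_ord0 addr0 addrA.
by congr (F _ + F _ + F _); exact: val_inj.
Qed.

(** * Integer points with small linear forms *)

(* Box principle on {0, ..., n'^2}^3 with n' = n + 1: more than n'^6 points fall
   into (n'^3)^2 cells of side C / n'. *)
Lemma small_forms (R : realType) (F1 F2 : 'I_3 -> R) : exists2 C : R, 0 < C &
  forall n : nat, exists z : 'rV[int]_3, [/\ z != 0,
    forall i, `|(z ord0 i)%:~R| <= n.+1%:R ^+ 2 :> R,
    `|\sum_i (z ord0 i)%:~R * F1 i| <= C / n.+1%:R &
    `|\sum_i (z ord0 i)%:~R * F2 i| <= C / n.+1%:R].
Proof.
pose S1 := \sum_i `|F1 i|; pose S2 := \sum_i `|F2 i|.
have S1_ge0 : 0 <= S1 by apply: sumr_ge0.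
have S2_ge0 : 0 <= S2 by apply: sumr_ge0.
(* On the box the form [Fi] ranges over an interval of length at most 2 N^2 [Si]. As 2 [Si] < [C],
   N^3 cells of width [C] / N cover it; the summand 1 keeps [C] positive even if both forms
   vanish. *)
pose C := 2 * (1 + S1 + S2); have C_gt0 : 0 < C by rewrite /C; lra.
exists C => // n; move: n.+1 (ltn0Sn n) => N N0.
have N_gt0 : 0 < N%:R :> R by rewrite ltr0n.
have N_neq0 := lt0r_neq0 N_gt0.
pose T := {ffun 'I_3 -> 'I_(N ^ 2).+1}.
pose form (F : 'I_3 -> R) (w : T) := \sum_i (w i)%:R * F i.
have form_bnd F w : `|form F w| <= N%:R ^+ 2 * \sum_i `|F i|.
  apply: (le_trans (ler_norm_sum _ _ _)); rewrite mulr_sumr; apply: ler_sum => i _.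
  rewrite normrM ler_wpM2r // ger0_norm ?ler0n // -natrX ler_nat -ltnS; exact: ltn_ord.
pose cell (F : 'I_3 -> R) (w : T) : nat :=
  Num.truncn ((form F w + N%:R ^+ 2 * \sum_i `|F i|) / (C / N%:R)).
have CN_gt0 : 0 < C / N%:R by rewrite divr_gt0.
have pre_ge0 F w : 0 <= (form F w + N%:R ^+ 2 * \sum_i `|F i|) / (C / N%:R).
  apply: divr_ge0; last exact: ltW.
  by have := form_bnd F w; rewrite ler_norml => /andP[]; lra.
have cell_bnd F w : 2 * \sum_i `|F i| < C -> (cell F w < N ^ 3)%N.
  move=> FC; rewrite truncn_lt_nat // ltr_pdivrMr // natrX.
  have -> : N%:R ^+ 3 * (C / N%:R) = N%:R ^+ 2 * C :> R by field.
  have := form_bnd F w; rewrite ler_norml => /andP[_ h].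
  apply: (@le_lt_trans _ _ (N%:R ^+ 2 * (2 * \sum_i `|F i|))); first by lra.
  by rewrite ltr_pM2l // exprn_gt0.
pose f (w : T) : 'I_(N ^ 3).-1.+1 * 'I_(N ^ 3).-1.+1 := (inord (cell F1 w), inord (cell F2 w)).
have N3 : (N ^ 3).-1.+1 = (N ^ 3)%N by rewrite prednK // expn_gt0 N0.
have /injectivePn[w [w' ww' eqf]] : ~~ injectiveb f.
  apply/negP => /injectiveP/leq_card.
  rewrite card_ffun card_prod !card_ord N3 -expnD -[(3 + 3)%N]/(2 * 3)%N expnM.
  by rewrite leqNgt ltn_exp2r // ltnSn.
have close F : 2 * \sum_i `|F i| < C -> cell F w = cell F w' ->
    `|form F w - form F w'| <= C / N%:R.
  move=> _ cE; have := truncn_itv (pre_ge0 F w); have := truncn_itv (pre_ge0 F w').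
  rewrite -/(cell F w) -/(cell F w') cE; move: (C / N%:R) CN_gt0 => c c_gt0.
  rewrite !ler_pdivlMr // !ltr_pdivrMr // => /andP[h1 h2] /andP[h3 h4].
  have e1 : (cell F w').+1%:R * c = (cell F w')%:R * c + c by rewrite -natr1 mulrDl mul1r.
  rewrite e1 in h2 h4.
  by rewrite ler_norml; apply/andP; split; lra.
have FC1 : 2 * \sum_i `|F1 i| < C by rewrite /C -/S1; lra.
have FC2 : 2 * \sum_i `|F2 i| < C by rewrite /C -/S2; lra.
have [c1 c2] : cell F1 w = cell F1 w' /\ cell F2 w = cell F2 w'.
  case: eqf => /(congr1 val) /= + /(congr1 val) /=.
  by rewrite !inordK // N3 cell_bnd.
exists (\row_i ((w i)%:Z - (w' i)%:Z)); split.
- apply: contra_neq ww' => /rowP z0; apply/ffunP => i; apply: val_inj.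
  by have := z0 i; rewrite !mxE => /eqP; rewrite subr_eq0 => /eqP[].
- move=> i; rewrite mxE intrB -!pmulrn ler_norml.
  have hw : (w i)%:R <= N%:R ^+ 2 :> R by rewrite -natrX ler_nat -ltnS ltn_ord.
  have hw' : (w' i)%:R <= N%:R ^+ 2 :> R by rewrite -natrX ler_nat -ltnS ltn_ord.
  have p : 0 <= (w i)%:R :> R by []. have p' : 0 <= (w' i)%:R :> R by [].
  by apply/andP; split; lra.
- have -> : \sum_i ((\row_i ((w i)%:Z - (w' i)%:Z)) ord0 i)%:~R * F1 i = form F1 w - form F1 w'.
    by rewrite -sumrB; apply: eq_bigr => i _; rewrite mxE intrB -!pmulrn mulrBl.
  exact: close.
- have -> : \sum_i ((\row_i ((w i)%:Z - (w' i)%:Z)) ord0 i)%:~R * F2 i = form F2 w - form F2 w'.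
    by rewrite -sumrB; apply: eq_bigr => i _; rewrite mxE intrB -!pmulrn mulrBl.
  exact: close.
Qed.

Lemma common_denominator (I : finType) (F : I -> rat) :
  exists2 d : nat, (0 < d)%N & forall i, d%:R * F i \is a Num.int.
Proof.
exists (\prod_i `|denq (F i)|)%N => [|i].
  by rewrite prodn_gt0 // => i; rewrite absz_gt0 denq_neq0.
rewrite (bigD1 i) //= natrM mulrAC rpredM ?rpred_nat //.
have -> : `|denq (F i)|%N%:R = (denq (F i))%:~R :> rat.
  by rewrite -[in RHS](gez0_abs (denq_ge0 _)).
by rewrite mulrC -numqE intr_int.
Qed.

(* Take a lattice vector whose first coordinate rho is tiny and add to a multiple
   of it a vector (N f2, N g2): correcting the first coordinate back to t makes the
   second one grow like N k (f1 g2 - f2 g1) / rho. *)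
Lemma lattice_approx (R : realType) (f1 g1 f2 g2 : R) :
  (forall k n : int, k%:~R * f1 + n%:~R * f2 = 0 -> k = 0 /\ n = 0) ->
  f1 * g2 - f2 * g1 != 0 ->
  forall t d M : R, 0 < d -> exists k n : int,
    `|k%:~R * f1 + n%:~R * f2 - t| < d /\ M < k%:~R * g1 + n%:~R * g2.
Proof.
move=> ind det0 t d M d0.
have f20 : f2 != 0.
  by apply/eqP => f20; have [] := ind 0 1; rewrite ?f20 ?mulr0 ?mul0r ?addr0.
(* Being below 1 makes the third integer coordinate vanish, being below [|f2|] makes [k] nonzero,
   and being below [d] gives the required precision. *)
pose eps := Num.min 1 (Num.min d `|f2|).
have eps0 : 0 < eps by rewrite !lt_min ltr01 d0 normr_gt0.
have eps1 : eps <= 1 by rewrite ge_min lexx.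
have epsd : eps <= d by rewrite !ge_min lexx orbT.
have epsf : eps <= `|f2| by rewrite !ge_min lexx !orbT.
(* The second form is the third coordinate itself, so the principle in three variables yields a
   vector in two. *)
have [C C0 HC] := small_forms (fun i => [:: f1; f2; 0]`_i) (fun i => [:: 0; 0; 1]`_i).
have [z [z0 _ hz1 hz2]] := HC (Num.truncn (C / eps)).
have Ce : C / (Num.truncn (C / eps)).+1%:R < eps.
  by rewrite ltr_pdivrMr ?ltr0n // mulrC -ltr_pdivrMr // truncnS_gt.
move: hz1 hz2; rewrite !sum_ord3 /= !(mulr0, mulr1, addr0, add0r).
move=> /le_lt_trans/(_ Ce) hz1 /le_lt_trans/(_ Ce) hz2.
have z20 : z ord0 i2 = 0.
  apply/eqP; apply: contraTT hz2 => hz; rewrite -leNgt (le_trans eps1) //.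
  by rewrite norm_intr_ge1 ?intr_int ?intr_eq0.
set k := z ord0 i0 in hz1; set n := z ord0 i1 in hz1.
have k0 : k != 0.
  apply: contra_ltN (lt_le_trans hz1 epsf) => /eqP k0.
  rewrite k0 mul0r add0r normrM ler_peMl //.
  have : n != 0.
    apply: contra_neq z0 => n0; apply/rowP => i; rewrite mxE.
    by move: i; apply: forall_ord3.
  by move=> n0; rewrite norm_intr_ge1 ?intr_int ?intr_eq0.
set rho := (_ + _) in hz1.
have rho0 : rho != 0.
  by apply: contra_neq k0 => /ind[].
set G := k%:~R * g1 + n%:~R * g2.
pose kap := k%:~R * (f1 * g2 - f2 * g1) / rho.
have kap0 : kap != 0 by rewrite /kap !mulf_neq0 ?invr_eq0 ?intr_eq0.
(* The last two terms absorb the part of the second coordinate that does not grow with N. *)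
pose M' := M + `|G| + `|t * G / rho|.
have [N hN] : exists N : int, M' < kap * N%:~R.
  case: (ltrgt0P kap) kap0 => // kap0 _.
    exists (Num.floor (M' / kap) + 1); rewrite mulrC -ltr_pdivrMr //.
    by case/andP: (floor_itv (M' / kap)).
  exists (Num.floor (M' / kap) - 1); rewrite mulrC -ltr_ndivlMr //.
  case/andP: (floor_itv (M' / kap)) => h _; rewrite intrB; lra.
(* Rounding [x] down to [j] leaves the first coordinate within [|rho|] of [t]. *)
pose x := (t - N%:~R * f2) / rho; pose j := Num.floor x.
have /andP[j1 j2] := floor_itv x; rewrite -/j intrD in j1 j2.
exists (j * k), (j * n + N); rewrite !intrD !intrM; split.
  have -> : j%:~R * k%:~R * f1 + (j%:~R * n%:~R + N%:~R) * f2 - t = (j%:~R - x) * rho.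
    by rewrite mulrBl /x divfK // /rho; ring.
  apply: lt_le_trans epsd; apply: le_lt_trans hz1.
  by rewrite normrM ler_piMl // ler_norml; apply/andP; split; lra.
have -> : j%:~R * k%:~R * g1 + (j%:~R * n%:~R + N%:~R) * g2
   = t * G / rho + kap * N%:~R - (x - j%:~R) * G.
  have -> : kap = (g2 * rho - f2 * G) / rho by rewrite /kap; congr (_ / _); rewrite /rho /G; ring.
  transitivity (j%:~R * G + N%:~R * g2); first by rewrite /G; ring.
  by rewrite /x; field.
have h1 : - `|t * G / rho| <= t * G / rho by rewrite lerNl ler_normr lexx orbT.
have h2 : (x - j%:~R) * G <= `|G|.
  apply: le_trans (ler_norm _) _; rewrite normrM ler_piMl // ler_norml.
  by apply/andP; split; lra.
rewrite /M' in hN; lra.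
Qed.

(** * Parametrisation of norm-one elements *)

(* C + j S, with j ^ 2 = tau, parametrises up to sign the norm-one elements of R[j]. *)
Record angle_param (R : realType) (tau : R) (C S : R -> R) : Prop := AngleParam {
  apC_cont : continuous C;
  apS_cont : continuous S;
  apC0 : C 0 = 1;
  apS0 : S 0 = 0;
  apCD : forall s t, C (s + t) = C s * C t + tau * S s * S t;
  apSD : forall s t, S (s + t) = S s * C t + C s * S t;
  ap_norm : forall t, C t ^+ 2 - tau * S t ^+ 2 = 1;
  apS_neq0 : forall t, 0 < t < 1 -> S t != 0;
  ap_surj : forall x y, x ^+ 2 - tau * y ^+ 2 = 1 ->
    exists sg t, [/\ sg = 1 \/ sg = -1, x = sg * C t & y = sg * S t]
}.

Lemma angle_param_circle (R : realType) : angle_param (-1 : R) cos sin.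
Proof.
split.
- exact: continuous_cos.
- exact: continuous_sin.
- exact: cos0.
- exact: sin0.
- by move=> s t; rewrite cosD; ring.
- by move=> s t; rewrite sinD; ring.
- by move=> t; rewrite mulN1r opprK cos2Dsin2.
- move=> t /andP[t0 t1]; rewrite gt_eqF // sin_gt0_pi // t0 /=.
  by apply: lt_le_trans t1 _; apply: le_trans (pi_ge2 R); rewrite ler1n.
- move=> x y; rewrite mulN1r opprK => xy.
  have x1 : -1 <= x <= 1 by apply/andP; split; nra.
  have sE : sin (acos x) = `|y|.
    by rewrite sin_acos // -sqrtr_sqr; congr Num.sqrt; lra.
  exists 1; have [y0|y0] := leP 0 y.
    by exists (acos x); rewrite !mul1r acosK ?in_itv //= sE ger0_norm //; split => //; left.
  exists (- acos x); rewrite !mul1r cosN sinN acosK ?in_itv //= sE ltr0_norm // opprK.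
  by split => //; left.
Qed.

(** These functions are cosh and sinh. As (x + y)(x - y) = 1, the sign of x + y selects the branch,
    and t is the logarithm of |x + y|. *)
Lemma angle_param_hyperbola (R : realType) :
  angle_param (1 : R) (fun t => (expR t + expR (- t)) / 2) (fun t => (expR t - expR (- t)) / 2).
Proof.
have cexp : continuous (fun t : R => expR t) by apply: continuous_expR.
have cexpN : continuous (fun t : R => expR (- t)).
  move=> t; apply: (@continuous_comp _ _ _ -%R expR).
    exact: opp_continuous.
  exact: continuous_expR.
have EN t : expR (- t) = (expR t)^-1 :> R by rewrite expRN.
have E0 t : expR t != 0 :> R by rewrite gt_eqF ?expR_gt0.
split.
- by move=> t; apply: cvgMr_tmp; apply: cvgD; [exact: cexp | exact: cexpN].
- by move=> t; apply: cvgMr_tmp; apply: cvgB; [exact: cexp | exact: cexpN].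
- by rewrite oppr0 expR0; field.
- by rewrite oppr0 expR0; field.
- by move=> s t; rewrite opprD !expRD; field.
- by move=> s t; rewrite opprD !expRD; field.
- by move=> t; rewrite EN; field.
- move=> t /andP[t0 _]; rewrite mulf_neq0 ?invr_eq0 ?pnatr_eq0 // subr_eq0 gt_eqF //.
  by rewrite ltr_expR; lra.
- move=> x y xy; have xy1 : (x + y) * (x - y) = 1 by rewrite -xy; ring.
  have [h|h|h] := ltrgt0P (x + y); last by rewrite h mul0r in xy1; lra.
    have iE : expR (- ln (x + y)) = x - y.
      by rewrite EN lnK ?posrE //; apply: (mulfI (lt0r_neq0 h)); rewrite xy1 divff ?lt0r_neq0.
    exists 1, (ln (x + y)); rewrite iE lnK ?posrE //; split; [by left | by field | by field].
  have h' : 0 < - (x + y) by lra.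
  have iE : expR (- ln (- (x + y))) = y - x.
    rewrite EN lnK ?posrE //; apply: (mulfI (lt0r_neq0 h')); rewrite divff ?lt0r_neq0 //.
    by rewrite -xy1; ring.
  exists (-1), (ln (- (x + y))); rewrite iE lnK ?posrE //; split; [by right | by field | by field].
Qed.

(** * Integral matrices and determinants of order three *)

Lemma det_int_num n (A : 'M[rat]_n) :
  (forall i j, A i j \is a Num.int) -> \det A \is a Num.int.
Proof.
move=> Aint; apply: rpred_sum => s _; apply: rpredM.
  by rewrite rpredX // rpredN rpred1.
by apply: rpred_prod.
Qed.

Lemma mulmx_int_num p q r (A : 'M[rat]_(p, q)) (B : 'M[rat]_(q, r)) :
  (forall i j, A i j \is a Num.int) -> (forall i j, B i j \is a Num.int) ->
  forall i j, (A *m B) i j \is a Num.int.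
Proof. by move=> Ai Bi i j; rewrite mxE rpred_sum // => k _; rewrite rpredM. Qed.

Lemma adjugate_int_num n (A : 'M[rat]_n) :
  (forall i j, A i j \is a Num.int) -> forall i j, (\adj A) i j \is a Num.int.
Proof.
move=> Ai i j; rewrite mxE rpredM ?rpredX ?rpredN ?rpred1 //.
by apply: det_int_num => k l; rewrite !mxE.
Qed.

Lemma det_ord3 (S : comPzRingType) (A : 'M[S]_3) : \det A =
  A i0 i0 * (A i1 i1 * A i2 i2 - A i1 i2 * A i2 i1)
  - A i0 i1 * (A i1 i0 * A i2 i2 - A i1 i2 * A i2 i0)
  + A i0 i2 * (A i1 i0 * A i2 i1 - A i1 i1 * A i2 i0).
Proof.
rewrite (expand_det_row _ i0) sum_ord3 /cofactor.
have E (B : 'M[S]_2) : \det B = B ord0 ord0 * B ord_max ord_max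
    - B ord0 ord_max * B ord_max ord0.
  rewrite (expand_det_row _ ord0) !big_ord_recl big_ord0 /cofactor !det_mx11 !mxE /=.
  have -> : lift ord0 ord0 = ord_max :> 'I_2 by apply: val_inj.
  have -> : lift ord_max ord0 = ord0 :> 'I_2 by apply: val_inj.
  by rewrite !expr0 expr1; ring.
rewrite !E !mxE /=.
have -> : lift i0 (ord0 : 'I_2) = i1 by apply: val_inj.
have -> : lift i0 (ord_max : 'I_2) = i2 by apply: val_inj.
have -> : lift i1 (ord0 : 'I_2) = i0 by apply: val_inj.
have -> : lift i1 (ord_max : 'I_2) = i2 by apply: val_inj.
have -> : lift i2 (ord0 : 'I_2) = i0 by apply: val_inj.
have -> : lift i2 (ord_max : 'I_2) = i1 by apply: val_inj.
by rewrite /= expr0 expr1 -signr_odd /= expr0; ring.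
Qed.

(** * Conjugates in a cubic field *)

Section CubicField.
Variables (R : realType) (a1 a2 : R) (m : 'I_3 -> 'I_3 -> 'I_3 -> rat).
Hypothesis indep : forall x : 'rV[rat]_3, embR a1 a2 x = 0 -> x = 0.
Hypothesis table : forall i j : 'I_3,
  basisK a1 a2 i * basisK a1 a2 j = \sum_(k < 3) ratr (m i j k) * basisK a1 a2 k.

Local Notation K := 'rV[rat]_3.
Local Notation e := (embR a1 a2).
Local Notation b := (basisK a1 a2).
Local Notation "x ** y" := (Kmul m x y) (at level 40, left associativity).
Local Notation M := (mulmat m).

Lemma embRD x y : e (x + y) = e x + e y.
Proof. by rewrite /embR -big_split; apply: eq_bigr => i _; rewrite mxE rmorphD mulrDl. Qed.

Lemma embRZ c x : e (c *: x) = ratr c * e x.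
Proof. by rewrite /embR mulr_sumr; apply: eq_bigr => i _; rewrite mxE rmorphM mulrA. Qed.

Lemma embRN x : e (- x) = - e x.
Proof. by rewrite -scaleN1r embRZ rmorphN1 mulN1r. Qed.

Lemma embRB x y : e (x - y) = e x - e y.
Proof. by rewrite embRD embRN. Qed.

Lemma embR0 : e 0 = 0.
Proof. by rewrite -(scale0r 0) embRZ rmorph0 mul0r. Qed.

(** Through this injection the field laws of K are inherited from R. *)
Lemma embR_inj : injective e.
Proof. by move=> x y h; apply/subr0_eq/indep; rewrite embRB h subrr. Qed.

Lemma embR_basis l : e (Kbasis l) = b l.
Proof.
rewrite /embR (bigD1 l) //= big1 ?addr0 /Kbasis ?mxE ?eqxx ?rmorph1 ?mul1r //.
by move=> i il; rewrite mxE eqxx (negbTE il) rmorph0 mul0r.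
Qed.

Lemma embR1 : e Kone = 1.
Proof. by rewrite /Kone embR_basis. Qed.

Lemma embRM x y : e (x ** y) = e x * e y.
Proof.
rewrite /embR mulr_suml.
under eq_bigr do rewrite mxE rmorph_sum mulr_suml.
rewrite exchange_big /=; apply: eq_bigr => i _.
under eq_bigr do rewrite rmorph_sum mulr_suml.
rewrite exchange_big /= mulr_sumr; apply: eq_bigr => j _.
rewrite mulrACA table mulr_sumr; apply: eq_bigr => k _.
by rewrite !rmorphM /= !mulrA.
Qed.

Lemma embR_eq0 x : (e x == 0) = (x == 0).
Proof. by apply/eqP/eqP => [/indep//|->]; rewrite embR0. Qed.

Lemma KmulC x y : x ** y = y ** x.
Proof. by apply: embR_inj; rewrite !embRM mulrC. Qed.

Lemma KmulA x y z : x ** (y ** z) = x ** y ** z.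
Proof. by apply: embR_inj; rewrite !embRM mulrA. Qed.

Lemma Kmul1 x : x ** Kone = x.
Proof. by apply: embR_inj; rewrite !embRM embR1 mulr1. Qed.

Lemma mulmat_col x k j : M x k j = (x ** Kbasis j) ord0 k.
Proof.
rewrite !mxE; apply: eq_bigr => i _.
rewrite (bigD1 j) //= big1 ?addr0 /Kbasis ?mxE ?eqxx ?mulr1 //.
by move=> l lj; rewrite mxE eqxx (negbTE lj) mulr0 mul0r.
Qed.

Lemma KmulE x y k : (x ** y) ord0 k = \sum_l M x k l * y ord0 l.
Proof.
rewrite mxE exchange_big; apply: eq_bigr => l _.
by rewrite mxE mulr_suml; apply: eq_bigr => i _; rewrite mulrAC.
Qed.

Lemma mulmatM x y : M (x ** y) = M x *m M y.
Proof.
apply/matrixP => k j; rewrite mulmat_col -KmulA KmulE mxE.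
by apply: eq_bigr => l _; rewrite -mulmat_col.
Qed.

Lemma mulmat1 : M Kone = 1%:M.
Proof.
apply/matrixP => k j; rewrite mulmat_col KmulC Kmul1 /Kbasis !mxE eqxx /=.
by rewrite eq_sym.
Qed.

Lemma mulmatD x y : M (x + y) = M x + M y.
Proof.
by apply/matrixP => k j; rewrite !mxE -big_split; apply: eq_bigr => i _; rewrite mxE mulrDl.
Qed.

Lemma mulmatZ c x : M (c *: x) = c *: M x.
Proof.
by apply/matrixP => k j; rewrite !mxE mulr_sumr; apply: eq_bigr => i _; rewrite mxE mulrA.
Qed.

Local Notation mr x k j := (ratr (M x k j) : R).

(** The row (1, a1, a2) is a left eigenvector of [M x] with eigenvalue [e x]; column j of this
    relation is solved for its top entry. *)
Lemma mulmat_eigen x j : mr x i0 j = e x * b j - a1 * mr x i1 j - a2 * mr x i2 j.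
Proof.
rewrite -(embR_basis j) -embRM {1}/embR sum_ord3 -!mulmat_col.
by rewrite /basisK /=; ring.
Qed.

(* The action of [M x] on the plane orthogonal to the common left eigenvector
   (1, a1, a2), in the basis (-a1, 1, 0), (-a2, 0, 1). *)
Definition B11 x := mr x i1 i1 - a1 * mr x i1 i0.
Definition B12 x := mr x i1 i2 - a2 * mr x i1 i0.
Definition B21 x := mr x i2 i1 - a1 * mr x i2 i0.
Definition B22 x := mr x i2 i2 - a2 * mr x i2 i0.

Lemma mrM x y k j : mr (x ** y) k j =
  mr x k i0 * mr y i0 j + mr x k i1 * mr y i1 j + mr x k i2 * mr y i2 j.
Proof.
rewrite -!rmorphM -!rmorphD; congr ratr; rewrite mulmatM.
by rewrite -(sum_ord3 (fun l => M x k l * M y l j)); exact: mxE.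
Qed.

Lemma mrD x y k j : mr (x + y) k j = mr x k j + mr y k j.
Proof. by rewrite mulmatD -rmorphD; congr ratr; exact: mxE. Qed.

Lemma mrZ c x k j : mr (c *: x) k j = ratr c * mr x k j.
Proof. by rewrite mulmatZ -rmorphM; congr ratr; exact: mxE. Qed.

Lemma mr1 k j : mr Kone k j = (k == j)%:R.
Proof. by rewrite mulmat1 mxE ratr_nat. Qed.

(** The plane is invariant under every [M x], so restriction to it is multiplicative. *)
Lemma BM x y :
  [/\ B11 (x ** y) = B11 x * B11 y + B12 x * B21 y,
      B12 (x ** y) = B11 x * B12 y + B12 x * B22 y,
      B21 (x ** y) = B21 x * B11 y + B22 x * B21 y &
      B22 (x ** y) = B21 x * B12 y + B22 x * B22 y].
Proof.
by split; rewrite /B11 /B12 /B21 /B22 !mrM !(mulmat_eigen y); rewrite /basisK /=; ring.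
Qed.

Lemma BD x y :
  [/\ B11 (x + y) = B11 x + B11 y, B12 (x + y) = B12 x + B12 y,
      B21 (x + y) = B21 x + B21 y & B22 (x + y) = B22 x + B22 y].
Proof.
by split; rewrite /B11 /B12 /B21 /B22 !mrD; ring.
Qed.

Lemma BZ c x :
  [/\ B11 (c *: x) = ratr c * B11 x, B12 (c *: x) = ratr c * B12 x,
      B21 (c *: x) = ratr c * B21 x & B22 (c *: x) = ratr c * B22 x].
Proof.
by split; rewrite /B11 /B12 /B21 /B22 !mrZ; ring.
Qed.

Lemma B1 : [/\ B11 Kone = 1, B12 Kone = 0, B21 Kone = 0 & B22 Kone = 1].
Proof.
by split; rewrite /B11 /B12 /B21 /B22 !mr1 /=; ring.
Qed.

(** On the quotient by the invariant plane [M x] acts as [e x]; this eigenvalue splits off from the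
    trace here and from the determinant in the next lemma. *)
Lemma Ktr_B x : ratr (Ktr m x) = e x + B11 x + B22 x.
Proof.
rewrite /Ktr /mxtrace sum_ord3 !rmorphD /= mulmat_eigen /B11 /B22 /basisK /=; ring.
Qed.

Lemma Knorm_B x : ratr (Knorm m x) = e x * (B11 x * B22 x - B12 x * B21 x).
Proof.
rewrite /Knorm det_ord3 !(rmorphD, rmorphN, rmorphM) /=.
rewrite !(mulmat_eigen x) /B11 /B22 /B12 /B21 /basisK /=; ring.
Qed.

(* With a = e x and y = (B11 + B22) / 2, vanishing of the discriminant makes
   (a - y)^2 and a + 2 y rational, so x is a root of a rational quadratic
   polynomial, of which y must then be a root as well. *)
Lemma disc_eq0_rat x : (B11 x - B22 x) ^+ 2 + 4 * B12 x * B21 x = 0 ->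
  x = (Ktr m x / 3) *: Kone.
Proof.
move=> disc0; apply: embR_inj; rewrite embRZ embR1 mulr1.
set a := e x; set y := (B11 x + B22 x) / 2.
set t := Ktr m x; set t2 := Ktr m (x ** x).
have tE : ratr t = a + 2 * y by rewrite Ktr_B -/a /y; field.
have [Bxx1 _ _ Bxx2] := BM x x.
have t2E : ratr t2 = a ^+ 2 + 2 * y ^+ 2.
  have -> : ratr t2 = a ^+ 2 + (2 * y ^+ 2)
     + ((B11 x - B22 x) ^+ 2 + 4 * B12 x * B21 x) / 2.
    by rewrite Ktr_B embRM -/a Bxx1 Bxx2 /y; field.
  by rewrite disc0; ring.
(* The coefficients come from (a - t / 3)^2 = 4 (a - y)^2 / 9, where 2 (a - y)^2 = 3 t2 - t^2. *)
pose c := 2 / 3 * t; pose d := (2 * (3 * t2 - t ^+ 2) - t ^+ 2) / 9.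
have cE : ratr c = 2 / 3 * (a + 2 * y) :> R.
  by rewrite -tE /c !rmorphM fmorphV !rmorph_nat.
have dE : ratr d = (2 * (3 * (a ^+ 2 + 2 * y ^+ 2) - (a + 2 * y) ^+ 2)
    - (a + 2 * y) ^+ 2) / 9 :> R.
  by rewrite -t2E -tE /d fmorph_div !(rmorph_nat, rmorphXn, rmorphM, rmorphN, rmorphD).
have xx : x ** x = c *: x + d *: Kone.
  by apply: embR_inj; rewrite embRM embRD !embRZ embR1 -/a cE dE; field.
have [D1 _ _ D2] := BD (c *: x) (d *: Kone).
have [Z1 _ _ Z2] := BZ c x.
have [U1 _ _ U2] := BZ d Kone.
have [V1 _ _ V2] := B1.
(* Taking the trace of [xx] shows that y satisfies the same quadratic equation as a. Since y - t / 3
   = -(a - y) / 3, this leaves only a = y. *)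
have : ratr t2 = ratr c * a + ratr d + ratr c * (2 * y) + 2 * ratr d :> R.
  by rewrite /t2 xx Ktr_B embRD !embRZ embR1 D1 D2 Z1 Z2 U1 U2 V1 V2 -/a /y; field.
rewrite t2E cE dE => h.
have ay : (a - y) ^+ 2 = 0.
  have /eqP := h; rewrite -subr_eq0 => /eqP h'.
  lra.
have /eqP : a - y = 0 by apply/eqP; rewrite -sqrf_eq0 ay.
rewrite subr_eq0 => /eqP ay'.
by rewrite fmorph_div rmorph_nat /= tE -ay'; field.
Qed.

(* Y + j Z, with j ^ 2 = tau, is a ring morphism to R[j] complementing the given real
   embedding: the conjugate embeddings are Y +- i Z if tau = -1, Y +- Z if tau = 1. *)
Record quadratic_conj (tau : R) (Y Z : K -> R) : Prop := QuadraticConj {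
  qcYD : forall x y, Y (x + y) = Y x + Y y;
  qcYZ : forall c x, Y (c *: x) = ratr c * Y x;
  qcZD : forall x y, Z (x + y) = Z x + Z y;
  qcZZ : forall c x, Z (c *: x) = ratr c * Z x;
  qcY1 : Y Kone = 1;
  qcZ1 : Z Kone = 0;
  qcYM : forall x y, Y (x ** y) = Y x * Y y + tau * Z x * Z y;
  qcZM : forall x y, Z (x ** y) = Y x * Z y + Z x * Y y;
  qc_tr : forall x, ratr (Ktr m x) = e x + 2 * Y x;
  qc_norm : forall x, ratr (Knorm m x) = e x * (Y x ^+ 2 - tau * Z x ^+ 2);
  qc_rat : forall x, Z x = 0 -> x = (Ktr m x / 3) *: Kone
}.

(** The 2 by 2 matrices B x commute, and B g for g = alpha1 is not scalar. So each B x is a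
    combination Y x + Z x J, where J is the traceless part of B g, scaled so that J^2 = tau. *)
Lemma quadratic_conj_exists :
  exists tau Y Z, (tau = 1 \/ tau = -1) /\ quadratic_conj tau Y Z.
Proof.
pose g := Kbasis i1.
(* The discriminant of the characteristic polynomial of B g: its sign is tau, and it is nonzero
   because alpha1 is irrational. *)
pose D := (B11 g - B22 g) ^+ 2 + 4 * B12 g * B21 g.
have D0 : D != 0.
  apply/eqP => /disc_eq0_rat/(congr1 (fun v : K => v ord0 i1)).
  rewrite /Kone /g /Kbasis !mxE /= mulr0 => /eqP.
  by rewrite oner_eq0.
pose tau := Num.sg D; pose d := Num.sqrt `|D| / 2.
have tau1 : tau = 1 \/ tau = -1.
  by rewrite /tau; case: sgrP D0 => // _ _; [left|right].
have tau2 : tau * tau = 1 by case: tau1 => ->; ring.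
have d0 : d != 0.
  by rewrite /d mulf_neq0 ?invr_eq0 ?pnatr_eq0 // sqrtr_eq0 -ltNge normr_gt0.
have dD : 4 * d ^+ 2 * tau = D.
  by rewrite /d expr_div_n sqr_sqrtr ?normr_ge0 // /tau {3}[D]numEsg; field.
(* J has rows (p, q) and (r, -p), so J^2 is the scalar p^2 + q r. *)
pose p := (B11 g - B22 g) / (2 * d); pose q := B12 g / d; pose r := B21 g / d.
have pqr : p ^+ 2 + q * r = tau.
  have -> : tau = D / (4 * d ^+ 2) by rewrite -dD; field.
  by rewrite /D /p /q /r; field.
(* Entries of the identity B x B g = B g B x. *)
have comm x : [/\ B12 x * r = q * B21 x, (B11 x - B22 x) * q = 2 * p * B12 x
    & (B11 x - B22 x) * r = 2 * p * B21 x].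
  have [h11 h12 h21 _] := BM x g; have [k11 k12 k21 _] := BM g x.
  move: k11 k12 k21; rewrite KmulC h11 h12 h21 => k11 k12 k21.
  have E1 : B12 x * B21 g = B12 g * B21 x by lra.
  have E2 : (B11 x - B22 x) * B12 g = (B11 g - B22 g) * B12 x by lra.
  have E3 : (B11 x - B22 x) * B21 g = (B11 g - B22 g) * B21 x by lra.
  split; rewrite /p /q /r.
  - by rewrite mulrA E1; field.
  - by rewrite mulrA E2; field.
  - by rewrite mulrA E3; field.
pose Y x := (B11 x + B22 x) / 2.
(* If B x = Y + Z J then J B x has trace 2 tau Z, and tau is its own inverse. *)
pose Z x := tau * (p * (B11 x - B22 x) + q * B21 x + r * B12 x) / 2.
have BE x : [/\ B11 x = Y x + Z x * p, B12 x = Z x * q, B21 x = Z x * r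
    & B22 x = Y x - Z x * p].
  have [E1 E2 E3] := comm x.
  have Zp : Z x * p = (B11 x - B22 x) / 2.
    have -> : Z x * p = tau * (p ^+ 2 * (B11 x - B22 x) + q * (2 * p * B21 x) / 2
      + r * (2 * p * B12 x) / 2) / 2 by rewrite /Z; field.
    by rewrite -E2 -E3 -[RHS]mul1r -[X in _ = X * _]tau2 -[X in _ = _ * X * _]pqr; field.
  have Zq : Z x * q = B12 x.
    have -> : Z x * q = tau * (p * ((B11 x - B22 x) * q) + q * (q * B21 x)
      + r * q * B12 x) / 2 by rewrite /Z; field.
    by rewrite -E1 E2 -[RHS]mul1r -[X in _ = X * _]tau2 -[X in _ = _ * X * _]pqr; field.
  have Zr : Z x * r = B21 x.
    have -> : Z x * r = tau * (p * ((B11 x - B22 x) * r) + r * (B12 x * r)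
      + r * q * B21 x) / 2 by rewrite /Z; field.
    by rewrite E1 E3 -[RHS]mul1r -[X in _ = X * _]tau2 -[X in _ = _ * X * _]pqr; field.
  by split; rewrite ?Zp ?Zq ?Zr // /Y; field.
exists tau, Y, Z; split => //; split.
- by move=> x y; have [h1 h2 h3 h4] := BD x y; rewrite /Y h1 h4; field.
- by move=> c x; have [h1 h2 h3 h4] := BZ c x; rewrite /Y h1 h4; field.
- by move=> x y; have [h1 h2 h3 h4] := BD x y; rewrite /Z h1 h2 h3 h4; field.
- by move=> c x; have [h1 h2 h3 h4] := BZ c x; rewrite /Z h1 h2 h3 h4; field.
- by have [h1 h2 h3 h4] := B1; rewrite /Y h1 h4; field.
- by have [h1 h2 h3 h4] := B1; rewrite /Z h1 h2 h3 h4; field.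
- move=> x y; have [h1 h2 h3 h4] := BM x y.
  rewrite {1}/Y h1 h4; have [-> -> -> ->] := BE x; have [-> -> -> ->] := BE y.
  by rewrite -pqr; field.
- move=> x y; have [h1 h2 h3 h4] := BM x y.
  rewrite {1}/Z h1 h2 h3 h4; have [-> -> -> ->] := BE x; have [-> -> -> ->] := BE y.
  by rewrite -[RHS]mul1r -[X in _ = X * _]tau2 -[X in _ = _ * X * _]pqr; field.
- by move=> x; rewrite Ktr_B /Y; field.
- move=> x; rewrite Knorm_B; have [-> -> -> ->] := BE x.
  by rewrite -pqr; ring.
- move=> x Zx0; apply: disc_eq0_rat; have [-> -> -> ->] := BE x.
  by rewrite Zx0; ring.
Qed.

(** * Inverses and the trace pairing *)

(** Multiplication by x is injective because K embeds in a field, hence bijective by finite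
    dimension. *)
Lemma Kmul_inv x : x != 0 -> exists y, x ** y = Kone.
Proof.
move=> x0; have xM y : (x ** y) = y *m (M x)^T.
  apply/rowP => k; rewrite KmulE [RHS]mxE; apply: eq_bigr => l _.
  by rewrite [in RHS]mxE mulrC.
have Mu : (M x)^T \in unitmx.
  rewrite -row_free_unit.
  apply: inj_row_free => v; rewrite -xM => /(congr1 e)/eqP.
  by rewrite embRM embR0 mulf_eq0 !embR_eq0 (negbTE x0) => /eqP.
by exists (Kone *m invmx (M x)^T); rewrite xM mulmxKV.
Qed.

Lemma KtrD x y : Ktr m (x + y) = Ktr m x + Ktr m y.
Proof. by rewrite /Ktr mulmatD linearD. Qed.

Lemma KtrZ c x : Ktr m (c *: x) = c * Ktr m x.
Proof. by rewrite /Ktr mulmatZ linearZ. Qed.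

Lemma KmulDl x y z : (x + y) ** z = x ** z + y ** z.
Proof. by apply: embR_inj; rewrite !(embRM, embRD) mulrDl. Qed.

Lemma KmulZl c x z : (c *: x) ** z = c *: (x ** z).
Proof. by apply: embR_inj; rewrite !(embRM, embRZ) mulrA. Qed.

Lemma Knorm_eq0 x : (Knorm m x == 0) = (x == 0).
Proof.
apply/idP/eqP => [|->]; last first.
  by rewrite /Knorm -(scale0r 0) mulmatZ scale0r det0.
apply: contraTeq => /Kmul_inv[y /(congr1 (fun z => \det (M z)))].
rewrite mulmatM det_mulmx mulmat1 det1 => xy1.
by apply: contra_eq_neq xy1 => /eqP x0; rewrite -/(Knorm m x) (eqP x0) mul0r eq_sym oner_eq0.
Qed.

Lemma KnormM x y : Knorm m (x ** y) = Knorm m x * Knorm m y.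
Proof. by rewrite /Knorm mulmatM det_mulmx. Qed.

(** On the dual lattice these values are the integers q, p1, p2 of an approximation point. *)
Definition pairing s l := Ktr m (s ** Kbasis l).

Definition trace_gram : 'M[rat]_3 := \matrix_(k, l) Ktr m (Kbasis k ** Kbasis l).

Lemma pairing_gram s l : pairing s l = (s *m trace_gram) ord0 l.
Proof.
rewrite mxE {1}(row_sum_delta s) /pairing.
elim/big_rec2: _ => [|k t w _ <-]; first by rewrite -(scale0r 0) KmulZl KtrZ mul0r.
by rewrite KmulDl KtrD KmulZl KtrZ [in RHS]mxE.
Qed.

(** A nonzero s is not orthogonal to its inverse, since Tr 1 = 3. *)
Lemma trace_gram_unit : trace_gram \in unitmx.
Proof.
rewrite -row_free_unit; apply: inj_row_free => s sT0; apply/eqP/negPn/negP => s0.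
have [y sy] := Kmul_inv s0.
have : Ktr m (s ** y) = 0.
  rewrite {1}(row_sum_delta y).
  elim/big_rec: _ => [|k w _ w0].
    by rewrite KmulC -(scale0r 0) KmulZl KtrZ mul0r.
  rewrite KmulC KmulDl KmulZl KtrD KtrZ KmulC -/(pairing s k) pairing_gram sT0.
  by rewrite mxE mulr0 add0r KmulC.
by rewrite sy /Ktr mulmat1 mxtrace1 => /eqP; rewrite pnatr_eq0.
Qed.

Lemma pairing_surj (w : K) : exists s, forall l, pairing s l = w ord0 l.
Proof.
exists (w *m invmx trace_gram) => l.
by rewrite pairing_gram mulmxKV // trace_gram_unit.
Qed.

Section Conjugates.
Variables (tau : R) (Y Z : K -> R).
Hypothesis tau1 : tau = 1 \/ tau = -1.
Hypothesis qc : quadratic_conj tau Y Z.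

Let tau2 : tau * tau = 1. Proof. by case: tau1 => ->; ring. Qed.

Local Notation Yb l := (Y (Kbasis l)).
Local Notation Zb l := (Z (Kbasis l)).

Lemma pairing_conj s l :
  ratr (pairing s l) = e s * b l + 2 * (Y s * Yb l + tau * Z s * Zb l).
Proof. by rewrite /pairing (qc_tr qc) embRM embR_basis (qcYM qc). Qed.

(* The square of this determinant is det(trace_gram) / (4 tau). *)
Lemma conj_det_neq0 : (a1 - Yb i1) * Zb i2 - (a2 - Yb i2) * Zb i1 != 0.
Proof.
have : \det trace_gram != 0 by rewrite -unitfE -unitmxE trace_gram_unit.
rewrite -(fmorph_eq0 (ratr : rat -> R)) => T0.
apply: contra_neq T0 => D0.
have T k l : ratr (trace_gram k l) = b k * b l + 2 * (Yb k * Yb l + tau * Zb k * Zb l).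
  by rewrite /trace_gram mxE -/(pairing _ _) pairing_conj embR_basis.
transitivity (4 * tau * ((a1 - Yb i1) * Zb i2 - (a2 - Yb i2) * Zb i1) ^+ 2); last first.
  by rewrite D0; ring.
rewrite det_ord3 !(rmorphM, rmorphN, rmorphD) /= !T.
rewrite -![Kbasis i0]/Kone !(qcY1 qc) !(qcZ1 qc) /basisK /=; ring.
Qed.

(** In q a_l - p_l the term with [e s] cancels, leaving 2 (Y s (a_l - Yb l) - tau Z s Zb l);
    Cramer's rule inverts this system of two equations. *)
Lemma pairing_coord : exists l1 l2 l3 l4 : R, l1 * l4 - l2 * l3 != 0 /\
  forall s, let u1 := ratr (pairing s i0) * a1 - ratr (pairing s i1) in
            let u2 := ratr (pairing s i0) * a2 - ratr (pairing s i2) in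
   Y s = l1 * u1 + l2 * u2 /\ Z s = l3 * u1 + l4 * u2.
Proof.
have D0 := conj_det_neq0; set D := (_ - _) in D0.
have DE : D = (a1 - Yb i1) * Zb i2 - (a2 - Yb i2) * Zb i1 by [].
exists (Zb i2 / (2 * D)), (- Zb i1 / (2 * D)), (tau * (a2 - Yb i2) / (2 * D)),
  (- tau * (a1 - Yb i1) / (2 * D)); split.
  have -> : Zb i2 / (2 * D) * (- tau * (a1 - Yb i1) / (2 * D)) -
    - Zb i1 / (2 * D) * (tau * (a2 - Yb i2) / (2 * D)) = - tau * D / (4 * D ^+ 2).
    by rewrite [X in _ = - tau * X / _]DE; field.
  rewrite !mulf_neq0 ?oppr_eq0 ?invr_eq0 ?mulf_neq0 ?expf_neq0 ?pnatr_eq0 //.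
  by apply/eqP => t0; move: tau2; rewrite t0 mul0r => /eqP; rewrite eq_sym oner_eq0.
move=> s u1 u2; rewrite /u1 /u2 !pairing_conj -[Kbasis i0]/Kone (qcY1 qc) (qcZ1 qc).
rewrite /basisK /=; split.
  rewrite [LHS](_ : _ = Y s * D / D); last by field.
  by rewrite [X in Y s * X / _]DE; field.
rewrite [LHS](_ : _ = tau * tau * Z s * D / D); last by rewrite tau2; field.
by rewrite [X in _ * Z s * X / _]DE; field.
Qed.



Lemma pairingE s : pairing s i0 = Ktr m s.
Proof. by rewrite /pairing -[Kbasis i0]/Kone Kmul1. Qed.

(** * Units *)

(** Equivalently, u maps the lattice spanned by 1, a1, a2 into itself, so it lies in the multiplier
    order of that lattice. *)
Definition integral u := forall k j, M u k j \is a Num.int.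

Lemma integralM u v : integral u -> integral v -> integral (u ** v).
Proof. by move=> ui vi k j; rewrite mulmatM mulmx_int_num. Qed.

Lemma integral1 : integral Kone.
Proof. by move=> k j; rewrite mulmat1 mxE rpred_nat. Qed.

Lemma Knorm1 : Knorm m Kone = 1.
Proof. by rewrite /Knorm mulmat1 det1. Qed.

Lemma mulmat_inv y y' : y ** y' = Kone -> M y' = (Knorm m y)^-1 *: \adj (M y).
Proof.
move=> yy'; have My : M y *m M y' = 1%:M by rewrite -mulmatM yy' mulmat1.
have y0 : Knorm m y != 0.
  apply/eqP => y0; have := congr1 determinant My; rewrite det_mulmx det1.
  by rewrite -/(Knorm m y) y0 mul0r => /eqP; rewrite eq_sym oner_eq0.
apply: (scalerI y0); rewrite scalerA divff // scale1r.
by rewrite -mul_scalar_mx -mul_adj_mx -mulmxA My mulmx1.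
Qed.

Lemma integral_inv y y' : y ** y' = Kone -> integral y -> Knorm m y = 1 -> integral y'.
Proof.
by move=> yy' yi y1 k j; rewrite (mulmat_inv yy') y1 invr1 scale1r adjugate_int_num.
Qed.

(* [x / y = 1 + (L / N y) w adj(y)] with [N y] dividing [L = B!] *)
Lemma integral_quotient (B : nat) x y y' w :
  integral y -> integral w -> y ** y' = Kone -> `|Knorm m y| <= B%:R ->
  x = y + (B`!)%:R *: w -> integral (x ** y').
Proof.
move=> yi wi yy' yB ->.
rewrite KmulDl yy' KmulZl => k j.
rewrite mulmatD mulmat1 mulmatZ mulmatM (mulmat_inv yy') -scalemxAr scalerA.
rewrite mxE rpredD //; first by rewrite mxE rpred_nat.
rewrite mxE rpredM //; last by rewrite mulmx_int_num // => *; rewrite adjugate_int_num.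
have /intrP[n nE] : Knorm m y \is a Num.int by exact: det_int_num.
have n0 : n != 0.
  apply/eqP => n0; have := congr1 (Knorm m) yy'; rewrite KnormM Knorm1 nE n0 mul0r.
  by move=> /eqP; rewrite eq_sym oner_eq0.
have nB : (0 < `|n| <= B)%N.
  by rewrite absz_gt0 n0 /= -(ler_nat rat) natr_absz intr_norm -nE.
have /dvdnP[q ->] : (`|n| %| B`!)%N by exact: dvdn_fact.
rewrite natrM nE natr_absz -mulrA rpredM ?rpred_nat //.
have nR : n%:~R != 0 :> rat by rewrite intr_eq0.
case: (lerP 0 n) => hn; first by rewrite ger0_norm // divff.
by rewrite ltr0_norm // rmorphN mulNr divff // rpredN.
Qed.

Lemma integral_lattice : exists2 d : nat, (0 < d)%N &
  forall z : 'rV[int]_3, integral (d%:R *: map_mx intr z).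
Proof.
have [d d0 dP] := common_denominator (fun t : 'I_3 * 'I_3 * 'I_3 => m t.1.1 t.1.2 t.2).
exists d => // z k j; rewrite mxE rpred_sum // => i _.
by rewrite !mxE mulrAC rpredM ?intr_int //; exact: (dP (i, j, k)).
Qed.

(* Iterating the hypothesis gives an infinite P-decreasing sequence of lattice points
   of bounded norm; two of them congruent modulo B! differ by a unit. *)
Lemma unit_quotient (P : K -> K -> Prop) (d B : nat) :
  (forall z : 'rV[int]_3, integral (d%:R *: map_mx intr z)) ->
  (forall x y z, P x y -> P y z -> P x z) ->
  (forall y, y != 0 -> exists z : 'rV[int]_3, let x := d%:R *: map_mx intr z in
    [/\ x != 0, `|Knorm m x| <= B%:R & P x y]) ->
  exists u y, [/\ integral u, Knorm m u ^+ 2 = 1, y != 0 & P (u ** y) y].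
Proof.
move=> dint Ptrans next.
pose lat (z : 'rV[int]_3) : K := d%:R *: map_mx intr z.
(* [choice] needs a total successor; 0 is a default at points with [lat z = 0], which the sequence
   never meets. *)
have next' (z : 'rV[int]_3) : exists z' : 'rV[int]_3, lat z != 0 ->
    [/\ lat z' != 0, `|Knorm m (lat z')| <= B%:R & P (lat z') (lat z)].
  have [z0|z0] := eqVneq (lat z) 0; first by exists 0.
  by have [z' hz'] := next _ z0; exists z'.
have K1 : Kone != 0 by rewrite -embR_eq0 embR1 oner_eq0.
have [z0 [hz0 hB0 _]] := next _ K1.
have [f fP] := choice next'.
pose zs n := iter n f z0; pose x n := lat (zs n).
have xP n : x n != 0 /\ `|Knorm m (x n)| <= B%:R.
  elim: n => [//|n [IH _]]; have [h1 h2 _] := fP _ IH; by split.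
have xdec n k : P (x (n + k).+1) (x n).
  elim: k => [|k IH]; first by rewrite addn0; have [_ _] := fP _ (xP n).1.
  apply: Ptrans IH; rewrite addnS.
  by have [_ _] := fP _ (xP (n + k).+1).1.
pose L := B`!; have L0 : (0 < L)%N := fact_gt0 B.
have resP (n : nat) (i : 'I_3) : (`|(zs n ord0 i %% L%:Z)%Z| < L)%N.
  by rewrite -ltz_nat gez0_abs ?modz_ge0 ?ltz_pmod //; rewrite gt_eqF.
pose col n : {ffun 'I_3 -> 'I_L} := [ffun i => Ordinal (resP n i)].
pose Nc := #|{ffun 'I_3 -> 'I_L}|.
have /injectivePn[n1 [n2 n12 ceq]] : ~~ injectiveb (fun n : 'I_Nc.+1 => col n).
  by apply/negP => /injectiveP/leq_card; rewrite card_ord ltnn.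
wlog lt12 : n1 n2 n12 ceq / (n1 < n2)%N.
  move=> W; case: (ltngtP n1 n2) => h; [exact: (W n1 n2)| |].
    by apply: (W n2 n1) => //; rewrite eq_sym.
  by move/val_inj: h n12 => ->; rewrite eqxx.
have [w wE] : exists w : 'rV[int]_3, zs n2 = zs n1 + L%:Z *: w.
  exists (\row_i ((zs n2 ord0 i %/ L%:Z)%Z - (zs n1 ord0 i %/ L%:Z)%Z)).
  apply/rowP => i; rewrite !mxE.
  have : (zs n2 ord0 i %% L%:Z)%Z = (zs n1 ord0 i %% L%:Z)%Z.
    move/ffunP: ceq => /(_ i); rewrite !ffunE => /(congr1 val) /= h.
    rewrite -[LHS]gez0_abs ?modz_ge0 ?gt_eqF //.
    by rewrite -[RHS]gez0_abs ?modz_ge0 ?gt_eqF // h.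
  move=> h; rewrite [LHS](divz_eq _ L%:Z) h [X in X + _ = _]mulrC.
  by rewrite {2}(divz_eq (zs n1 ord0 i) L%:Z); ring.
have xE : x n2 = x n1 + L%:R *: lat w.
  rewrite /x /lat wE; apply/rowP => i; rewrite !mxE intrD intrM -pmulrn; ring.
have xE' : x n1 = x n2 + L%:R *: lat (- w).
  by rewrite xE /lat map_mxN !scalerN addrK.
have [y1 hy1] := Kmul_inv (xP n1).1; have [y2 hy2] := Kmul_inv (xP n2).1.
have i1 : integral (x n2 ** y1).
  exact: (@integral_quotient B _ _ _ _ (dint _) (dint _) hy1 (xP n1).2 xE).
have i2 : integral (x n1 ** y2).
  exact: (@integral_quotient B _ _ _ _ (dint _) (dint _) hy2 (xP n2).2 xE').
exists (x n2 ** y1), (x n1); split => //.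
(* The two quotients are integral and mutually inverse, so their integer norms multiply to 1 and
   have absolute value 1. *)
- have NN : Knorm m (x n2 ** y1) * Knorm m (x n1 ** y2) = 1.
    transitivity (Knorm m (x n1 ** y1) * Knorm m (x n2 ** y2)).
      by rewrite !KnormM; ring.
    by rewrite hy1 hy2 Knorm1 mulr1.
  have h1 : Knorm m (x n2 ** y1) != 0.
    by apply/eqP => h; move/eqP: NN; rewrite h mul0r eq_sym oner_eq0.
  have h2 : Knorm m (x n1 ** y2) != 0.
    by apply/eqP => h; move/eqP: NN; rewrite h mulr0 eq_sym oner_eq0.
  have g1 := norm_intr_ge1 (det_int_num i1) h1.
  have g2 := norm_intr_ge1 (det_int_num i2) h2.
  rewrite -real_normK ?num_real //.
  suff -> : `|Knorm m (x n2 ** y1)| = 1 by rewrite expr1n.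
  apply/le_anti; rewrite g1 andbT.
  by rewrite -[leRHS](normr1 rat) -NN normrM ler_peMr.
- exact: (xP n1).1.
- have -> : x n2 ** y1 ** x n1 = x n2 by rewrite -KmulA (KmulC y1) hy1 Kmul1.
  by have := xdec n1 (n2 - n1).-1; rewrite -addnS prednK ?subn_gt0 // subnKC // ltnW.
Qed.

Definition Qlinear (F : K -> R) :=
  (forall x y, F (x + y) = F x + F y) /\ (forall c x, F (c *: x) = ratr c * F x).

Lemma Qlinear_lattice F (d : nat) (z : 'rV[int]_3) : Qlinear F ->
  F (d%:R *: map_mx intr z) = d%:R * \sum_i (z ord0 i)%:~R * F (Kbasis i).
Proof.
move=> [FD FZ]; rewrite FZ ratr_nat; congr (_ * _).
rewrite (row_sum_delta (map_mx intr z)).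
elim/big_rec2: _ => [|i x y _ <-]; first by rewrite -(scale0r 0) FZ rmorph0 mul0r.
by rewrite FD FZ mxE ratr_int.
Qed.

(** The box principle gives lattice points with [F1] and [F2] of order 1 / N and [E] of order N^2,
    so their norms stay below a bound independent of N. The last hypothesis lets such a point follow
    any given y, as [unit_quotient] requires. *)
Lemma small_unit (E F1 F2 : K -> R) (c : R) (P : K -> K -> Prop) :
  Qlinear E -> Qlinear F1 -> Qlinear F2 -> 0 <= c ->
  (forall x t, `|F1 x| <= t -> `|F2 x| <= t ->
     `|ratr (Knorm m x)| <= c * `|E x| * t ^+ 2) ->
  (forall x y z, P x y -> P y z -> P x z) ->
  (forall y, y != 0 -> exists2 eta : R, 0 < eta &
     forall x, `|F1 x| < eta -> `|F2 x| < eta -> P x y) ->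
  exists u y, [/\ integral u, Knorm m u ^+ 2 = 1, y != 0 & P (u ** y) y].
Proof.
move=> Elin F1lin F2lin c0 Nbnd Ptrans Psmall.
have [d d0 dint] := integral_lattice.
have dR : 0 < d%:R :> R by rewrite ltr0n.
have [C C0 HC] := small_forms (fun i => F1 (Kbasis i)) (fun i => F2 (Kbasis i)).
pose SE := \sum_i `|E (Kbasis i)|.
have SE0 : 0 <= SE by rewrite sumr_ge0.
pose B := (Num.truncn (c * (d%:R * SE) * (d%:R * C) ^+ 2)).+1.
have BE : c * (d%:R * SE) * (d%:R * C) ^+ 2 <= B%:R by rewrite ltW // truncnS_gt.
apply: (@unit_quotient P d B) => // y y0.
have [eta eta0 Peta] := Psmall y y0.
have [z [z0 zb z1 z2]] := HC (Num.truncn (d%:R * C / eta)).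
move: (Num.truncn _).+1 (truncnS_gt (d%:R * C / eta)) (ltn0Sn (Num.truncn (d%:R * C / eta)))
  zb z1 z2 => N NE N0 zb z1 z2.
have NR : 0 < N%:R :> R by rewrite ltr0n.
exists z => x.
have Fx F : Qlinear F -> `|\sum_i (z ord0 i)%:~R * F (Kbasis i)| <= C / N%:R ->
    `|F x| <= d%:R * C / N%:R.
  by move=> Fl h; rewrite Qlinear_lattice // normrM normr_nat -mulrA ler_wpM2l // ltW.
have Ceta : d%:R * C / N%:R < eta by rewrite ltr_pdivrMr // (mulrC eta) -ltr_pdivrMr.
split.
- rewrite scaler_eq0 negb_or pnatr_eq0 -lt0n d0 /=.
  apply: contra_neq z0 => /rowP h; apply/rowP => i.
  by have /eqP := h i; rewrite !mxE intr_eq0 => /eqP.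
- rewrite -(ler_rat R) ratr_norm ratr_nat; apply: le_trans BE.
  apply: (le_trans (Nbnd _ _ (Fx _ F1lin z1) (Fx _ F2lin z2))).
  have Ex : `|E x| <= d%:R * SE * N%:R ^+ 2.
    rewrite Qlinear_lattice // normrM normr_nat -mulrA ler_wpM2l ?(ltW dR) //.
    apply: (le_trans (ler_norm_sum _ _ _)); rewrite mulr_suml.
    by apply: ler_sum => i _; rewrite normrM mulrC ler_wpM2l.
  have -> : c * (d%:R * SE) * (d%:R * C) ^+ 2 =
     c * (d%:R * SE * N%:R ^+ 2) * (d%:R * C / N%:R) ^+ 2 by field; rewrite lt0r_neq0.
  by rewrite ler_wpM2r ?sqr_ge0 // ler_wpM2l.
- by apply: Peta; apply: le_lt_trans Ceta; exact: Fx.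
Qed.

(** * Angle and logarithmic size of units *)

Section Units.
Variables (C S : R -> R).
Hypothesis apm : angle_param tau C S.

(* f is the angle and 2 g the logarithmic size of the unit u. *)
Definition unit_at u (f g : R) :=
  [/\ integral u, e u = expR (2 * g), Y u = expR (- g) * C f & Z u = expR (- g) * S f].

Lemma unit_at_norm u f g : unit_at u f g -> Knorm m u = 1.
Proof.
move=> [_ ue uY uZ]; apply: (fmorph_inj (ratr : {rmorphism rat -> R})).
rewrite /= (qc_norm qc) ue uY uZ rmorph1.
transitivity (expR (2 * g) * expR (- g) ^+ 2 * (C f ^+ 2 - tau * S f ^+ 2)); first by ring.
rewrite (ap_norm apm) mulr1 expr2 -!expRD (_ : _ + _ = 0) ?expR0 //; ring.
Qed.

Lemma unit_at1 : unit_at Kone 0 0.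
Proof.
split; first exact: integral1.
- by rewrite embR1 mulr0 expR0.
- by rewrite (qcY1 qc) oppr0 expR0 (apC0 apm) mulr1.
- by rewrite (qcZ1 qc) (apS0 apm) mulr0.
Qed.

Lemma unit_atM u v f g f' g' : unit_at u f g -> unit_at v f' g' ->
  unit_at (u ** v) (f + f') (g + g').
Proof.
move=> [ui ue uY uZ] [vi ve vY vZ]; split; first exact: integralM.
- by rewrite embRM ue ve -expRD mulrDr.
- by rewrite (qcYM qc) uY uZ vY vZ (apCD apm) opprD expRD; ring.
- by rewrite (qcZM qc) uY uZ vY vZ (apSD apm) opprD expRD; ring.
Qed.

Lemma unit_atV u f g : unit_at u f g -> exists v, unit_at v (- f) (- g).
Proof.
move=> ug; have [ui ue uY uZ] := ug.
have u0 : u != 0.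
  by rewrite -embR_eq0 ue gt_eqF // expR_gt0.
have [v uv] := Kmul_inv u0; exists v.
(* The parity of [C] and [S] follows from the addition formulas at f and -f and the norm
   identity. *)
have CN : C (- f) = C f.
  have h1 := apCD apm f (- f); have h2 := apSD apm f (- f).
  rewrite subrr (apC0 apm) in h1; rewrite subrr (apS0 apm) in h2.
  rewrite -[LHS]mul1r -(ap_norm apm f) -[RHS]mulr1 h1.
  rewrite (_ : C f * (C f * C (- f) + tau * S f * S (- f)) =
    C f ^+ 2 * C (- f) + tau * S f * (C f * S (- f))); last by ring.
  have -> : C f * S (- f) = - (S f * C (- f)) by apply/eqP; rewrite -addr_eq0 addrC -h2.
  ring.
have SN : S (- f) = - S f.
  have h1 := apCD apm f (- f); have h2 := apSD apm f (- f).
  rewrite subrr (apC0 apm) in h1; rewrite subrr (apS0 apm) in h2.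
  rewrite -[LHS]mul1r -(ap_norm apm f) -[RHS]mulr1 h1.
  rewrite (_ : (C f ^+ 2 - tau * S f ^+ 2) * S (- f) =
    C f * (S f * C (- f) + C f * S (- f)) - S f * (C f * C (- f) + tau * S f * S (- f))); last by ring.
  by rewrite -h2 -h1; ring.
have ev : e u * e v = 1 by rewrite -embRM uv embR1.
have Yv : Y u * Y v + tau * Z u * Z v = 1 by rewrite -(qcYM qc) uv (qcY1 qc).
have Zv : Y u * Z v + Z u * Y v = 0 by rewrite -(qcZM qc) uv (qcZ1 qc).
have E0 : expR (- g) != 0 by rewrite gt_eqF // expR_gt0.
have Nu : Y u ^+ 2 - tau * Z u ^+ 2 = expR (- g) ^+ 2.
  by rewrite uY uZ -[RHS]mulr1 -(ap_norm apm f); ring.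
have egg : expR (- g) * expR (- - g) = 1 by rewrite -expRD subrr expR0.
split.
- exact: integral_inv uv ui (unit_at_norm ug).
- have e0 : e u != 0 by rewrite embR_eq0.
  by apply: (mulfI e0); rewrite ev ue -expRD mulrN subrr expR0.
- apply: (mulfI (expf_neq0 2 E0)); rewrite -{1}Nu CN.
  transitivity (Y u * (Y u * Y v + tau * Z u * Z v) - tau * Z u * (Y u * Z v + Z u * Y v)).
    by ring.
  by rewrite Yv Zv uY expr2 mulr0 subr0 mulr1 -[LHS]mul1r -egg; ring.
- apply: (mulfI (expf_neq0 2 E0)); rewrite -{1}Nu SN.
  transitivity (Y u * (Y u * Z v + Z u * Y v) - Z u * (Y u * Y v + tau * Z u * Z v)).
    by ring.
  by rewrite Yv Zv uZ expr2 mulr0 sub0r mulr1 -[LHS]mul1r -egg; ring.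
Qed.

Lemma unit_at_zmul u f g : unit_at u f g ->
  forall k : int, exists v, unit_at v (k%:~R * f) (k%:~R * g).
Proof.
move=> ug.
have pos (n : nat) : exists v, unit_at v (n%:R * f) (n%:R * g).
  elim: n => [|n [v hv]]; first by exists Kone; rewrite !mul0r; exact: unit_at1.
  by exists (u ** v); rewrite -nat1r !mulrDl !mul1r; exact: unit_atM.
case=> n; first exact: pos.
have [v hv] := pos n.+1; have [w hw] := unit_atV hv.
by exists w; rewrite NegzE !mulrNz -!pmulrn !mulNr.
Qed.

(** Products of powers realise every integer combination of (f1, g1) and (f2, g2), and
    [lattice_approx] applies to these. *)
Lemma units_dense u1 f1 g1 u2 f2 g2 : unit_at u1 f1 g1 -> unit_at u2 f2 g2 ->
  f1 * g2 - f2 * g1 != 0 ->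
  forall t d B, 0 < d -> exists u f g, [/\ unit_at u f g, `|f - t| < d & B < g].
Proof.
move=> h1 h2 det0 t d B d0.
have comb k n : exists u, unit_at u (k%:~R * f1 + n%:~R * f2) (k%:~R * g1 + n%:~R * g2).
  have [v1 hv1] := unit_at_zmul h1 k; have [v2 hv2] := unit_at_zmul h2 n.
  by exists (v1 ** v2); exact: unit_atM.
(* At angle 0 one has Z u = 0, so u is rational; then exp (2 g) = exp (-g) forces g = 0, and the
   determinant forces k = n = 0. *)
have ind (k n : int) : k%:~R * f1 + n%:~R * f2 = 0 -> k = 0 /\ n = 0.
  move=> f0; have [u] := comb k n; rewrite f0.
  set g := k%:~R * g1 + _ => - [ui ue uY uZ].
  have g0 : g = 0.
    have Z0 : Z u = 0 by rewrite uZ (apS0 apm) mulr0.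
    have uE := qc_rat qc Z0.
    have : e u = Y u by rewrite uE embRZ (qcYZ qc) embR1 (qcY1 qc).
    by rewrite ue uY (apC0 apm) mulr1 => /expR_inj; lra.
  have k0 : k%:~R * (f1 * g2 - f2 * g1) = 0 :> R.
    transitivity ((k%:~R * f1 + n%:~R * f2) * g2 - f2 * g); first by rewrite /g; ring.
    by rewrite f0 g0 mul0r mulr0 subrr.
  have n0 : n%:~R * (f1 * g2 - f2 * g1) = 0 :> R.
    transitivity (f1 * g - (k%:~R * f1 + n%:~R * f2) * g1); first by rewrite /g; ring.
    by rewrite f0 g0 mul0r mulr0 subrr.
  split; apply/eqP; rewrite -(intr_eq0 R); apply/eqP; apply: (mulIf det0).
    by rewrite k0 mul0r.
  by rewrite n0 mul0r.
have [k [n [hf hg]]] := lattice_approx ind det0 t B d0.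
by have [u hu] := comb k n; exists u, (k%:~R * f1 + n%:~R * f2), (k%:~R * g1 + n%:~R * g2).
Qed.

Definition pow4 u := (u ** u) ** (u ** u).

(* The first squaring makes the two components of the norm positive, the second
   removes the sign in [ap_surj]. *)
Lemma unit_at_exists u : integral u -> Knorm m u ^+ 2 = 1 ->
  exists f g, unit_at (pow4 u) f g.
Proof.
move=> ui u1; set v := u ** u.
have v1 : Knorm m v = 1 by rewrite KnormM -expr2.
have vi : integral v by exact: integralM.
have u0 : u != 0.
  by rewrite -Knorm_eq0; apply/eqP => h; move/eqP: u1; rewrite h expr0n eq_sym oner_eq0.
have ev : 0 < e v by rewrite embRM -expr2 exprn_even_gt0 //= embR_eq0.
have Nv : e v * (Y v ^+ 2 - tau * Z v ^+ 2) = 1 by rewrite -(qc_norm qc) v1 rmorph1.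
pose g := ln (e v) / 2.
have eg : e v = expR (2 * g) by rewrite /g mulrC divfK ?pnatr_eq0 // lnK.
have egg : expR (2 * g) = expR g ^+ 2 by rewrite expr2 -expRD; congr expR; ring.
have egN : expR (- g) * expR g = 1 by rewrite -expRD addNr expR0.
have [|sg [t [sg1 Yt Zt]]] := ap_surj apm (x := Y v * expR g) (y := Z v * expR g).
  by rewrite -[RHS]Nv eg egg; ring.
have sg2 : sg * sg = 1 by case: sg1 => ->; ring.
have Yv : Y v = expR (- g) * (sg * C t) by rewrite -Yt mulrCA egN mulr1.
have Zv : Z v = expR (- g) * (sg * S t) by rewrite -Zt mulrCA egN mulr1.
exists (t + t), (g + g); split; first exact: integralM.
- by rewrite embRM -/v eg -expRD mulrDr.
- rewrite (qcYM qc) -/v Yv Zv (apCD apm) opprD expRD -[RHS]mul1r -{1}sg2; ring.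
- rewrite (qcZM qc) -/v Yv Zv (apSD apm) opprD expRD -[RHS]mul1r -{1}sg2; ring.
Qed.

End Units.

Lemma pow4_lt1 (F : K -> R) u : (forall x y, F (x ** y) = F x * F y) ->
  `|F u| < 1 -> F (pow4 u) < 1.
Proof.
move=> FM Fu; rewrite /pow4 !FM -!expr2 exprn_ilt1 ?sqr_ge0 //.
by rewrite -real_normK ?num_real // exprn_ilt1.
Qed.

(** Comparing Y^2 + Z^2 yields a unit whose complex conjugates lie inside the unit circle, so its g
    is nonzero. *)
Lemma units_dense_complex : tau = -1 -> forall t d B, 0 < d ->
  exists u f g, [/\ unit_at cos sin u f g, `|f - t| < d & B < g].
Proof.
move=> tauN; have apm : angle_param tau cos sin by rewrite tauN; exact: angle_param_circle.
pose P x y := Y x ^+ 2 + Z x ^+ 2 < Y y ^+ 2 + Z y ^+ 2.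
have normE x : ratr (Knorm m x) = e x * (Y x ^+ 2 + Z x ^+ 2).
  by rewrite (qc_norm qc) tauN mulN1r opprK.
have [|||||||u [y [ui u1 y0 uP]]] := @small_unit e Y Z 2 P.
- by split; [exact: embRD | exact: embRZ].
- by split; [exact: (qcYD qc) | exact: (qcYZ qc)].
- by split; [exact: (qcZD qc) | exact: (qcZZ qc)].
- by [].
- move=> x t Yt Zt; rewrite normE normrM [2 * _]mulrC -mulrA ler_wpM2l //.
  rewrite ger0_norm ?addr_ge0 ?sqr_ge0 //.
  have h1 : Y x ^+ 2 <= t ^+ 2.
    by rewrite -real_normK ?num_real // lerXn2r ?nnegrE // (le_trans _ Yt).
  have h2 : Z x ^+ 2 <= t ^+ 2.
    by rewrite -real_normK ?num_real // lerXn2r ?nnegrE // (le_trans _ Zt).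
  lra.
- by move=> x y z; exact: lt_trans.
- move=> y y0; pose q := Y y ^+ 2 + Z y ^+ 2.
  have q0 : 0 < q.
    rewrite lt0r addr_ge0 ?sqr_ge0 // andbT; apply: contra_neq y0 => q0.
    by apply/eqP; rewrite -Knorm_eq0 -(fmorph_eq0 (ratr : {rmorphism rat -> R})) /= normE -/q q0 mulr0.
  exists (Num.min 1 (q / 2)); first by rewrite lt_min ltr01 divr_gt0.
  move=> x; rewrite !lt_min => /andP[Y1 Y2] /andP[Z1 Z2].
  have sq w : `|w| < 1 -> `|w| < q / 2 -> w ^+ 2 < q / 2.
    move=> w1 w2; rewrite -real_normK ?num_real // expr2; apply: le_lt_trans w2.
    by rewrite ler_piMl // ltW.
  by rewrite /P -/q; have := sq _ Y1 Y2; have := sq _ Z1 Z2; lra.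
have qu : Y u ^+ 2 + Z u ^+ 2 < 1.
  have q0 : 0 < Y y ^+ 2 + Z y ^+ 2.
    by apply: le_lt_trans uP; rewrite addr_ge0 ?sqr_ge0.
  rewrite -(ltr_pM2r q0) mul1r; apply: le_lt_trans uP.
  by rewrite (qcYM qc) (qcZM qc) tauN le_eqVlt; apply/orP; left; apply/eqP; ring.
have [f [g ug]] := unit_at_exists apm ui u1.
(* The element 1 also has angle 2 pi, which serves as the second generator. *)
have twopi : unit_at cos sin Kone (pi *+ 2) 0.
  have [h1 h2 h3 h4] := unit_at1 apm; split => //.
    by rewrite h3 cos0 cos2pi.
  by rewrite h4 sin0 sin2pi.
apply: (units_dense apm ug twopi); rewrite mulr0 sub0r oppr_eq0.
rewrite mulf_neq0 //; first by rewrite mulrn_eq0 /= gt_eqF // pi_gt0.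
have [_ _ wY wZ] := ug; apply/eqP => g0.
have : (Y u ^+ 2 + Z u ^+ 2) ^+ 4 < 1.
  by rewrite exprn_ilt1 // addr_ge0 ?sqr_ge0.
have -> : (Y u ^+ 2 + Z u ^+ 2) ^+ 4 = Y (pow4 u) ^+ 2 + Z (pow4 u) ^+ 2.
  by rewrite /pow4 !(qcYM qc, qcZM qc) tauN; ring.
rewrite wY wZ g0 oppr0 expR0 !mul1r => h.
have := cos2Dsin2 f; lra.
Qed.

(** The conjugate [E] left to expand is a parameter, so that different choices of it give
    independent units. *)
Lemma unit_contracting (E F1 F2 : K -> R) :
  Qlinear E -> Qlinear F1 -> Qlinear F2 ->
  (forall x y, F1 (x ** y) = F1 x * F1 y) -> (forall x y, F2 (x ** y) = F2 x * F2 y) ->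
  (forall x, ratr (Knorm m x) = E x * F1 x * F2 x) ->
  exists u, [/\ integral u, Knorm m u ^+ 2 = 1, `|F1 u| < 1 & `|F2 u| < 1].
Proof.
move=> El F1l F2l F1M F2M normE.
pose P x y := `|F1 x| < `|F1 y| /\ `|F2 x| < `|F2 y|.
have [||||u [y [ui u1 y0 uP]]] := @small_unit E F1 F2 1 P El F1l F2l.
- by [].
- move=> x t h1 h2; rewrite normE !normrM mul1r -mulrA ler_wpM2l // expr2.
  exact: ler_pM.
- by move=> x y z [h1 h2] [h3 h4]; split; [exact: lt_trans h3 | exact: lt_trans h4].
- move=> y; rewrite -Knorm_eq0 -(fmorph_eq0 (ratr : {rmorphism rat -> R})) /= normE.
  rewrite !mulf_eq0 !negb_or -andbA => /and3P[_ h1 h2].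
  exists (Num.min `|F1 y| `|F2 y|); first by rewrite lt_min !normr_gt0 h1 h2.
  by move=> x; rewrite !lt_min => /andP[? _] /andP[_ ?]; split.
exists u; split => //.
- have [h _] := uP; have y1 : 0 < `|F1 y| by exact: le_lt_trans h.
  by move: h; rewrite F1M normrM gtr_pMl.
- have [_ h] := uP; have y2 : 0 < `|F2 y| by exact: le_lt_trans h.
  by move: h; rewrite F2M normrM gtr_pMl.
Qed.

Lemma units_dense_real : tau = 1 -> forall t d B, 0 < d ->
  exists u f g, [/\ unit_at (fun t => (expR t + expR (- t)) / 2)
    (fun t => (expR t - expR (- t)) / 2) u f g, `|f - t| < d & B < g].
Proof.
set C := fun t => _; set S := fun t => _.
move=> tau1'; have apm : angle_param tau C S by rewrite tau1'; exact: angle_param_hyperbola.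
pose F x := Y x + Z x; pose G x := Y x - Z x.
have el : Qlinear e by split; [exact: embRD | exact: embRZ].
have Fl : Qlinear F.
  by split => [x y|c x]; rewrite /F (qcYD qc, qcYZ qc) (qcZD qc, qcZZ qc); ring.
have Gl : Qlinear G.
  by split => [x y|c x]; rewrite /G (qcYD qc, qcYZ qc) (qcZD qc, qcZZ qc); ring.
have FM x y : F (x ** y) = F x * F y by rewrite /F (qcYM qc) (qcZM qc) tau1'; ring.
have GM x y : G (x ** y) = G x * G y by rewrite /G (qcYM qc) (qcZM qc) tau1'; ring.
have normE x : ratr (Knorm m x) = e x * F x * G x.
  by rewrite (qc_norm qc) tau1' /F /G; ring.
have normE' x : ratr (Knorm m x) = F x * e x * G x by rewrite normE; ring.
(* One unit contracts [F] and [G], the other [e] and [G]. In logarithms |f1| < g1 and 0 < -g2 < f2,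
   which makes the determinant negative. *)
have [u [ui u1 uF uG]] := unit_contracting el Fl Gl FM GM normE.
have [v [vi v1 ve vG]] := unit_contracting Fl el Gl embRM GM normE'.
have [f1 [g1 h1]] := unit_at_exists apm ui u1.
have [f2 [g2 h2]] := unit_at_exists apm vi v1.
apply: (units_dense apm h1 h2).
have FE w f g : unit_at C S w f g -> F w = expR (f - g).
  by move=> [_ _ wY wZ]; rewrite /F wY wZ /C /S expRD; field.
have GE w f g : unit_at C S w f g -> G w = expR (- f - g).
  by move=> [_ _ wY wZ]; rewrite /G wY wZ /C /S expRD; field.
have c1 := pow4_lt1 FM uF; have c2 := pow4_lt1 GM uG.
have d1 := pow4_lt1 embRM ve; have d2 := pow4_lt1 GM vG.
rewrite (FE _ _ _ h1) expR_lt1 in c1; rewrite (GE _ _ _ h1) expR_lt1 in c2.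
have [_ we _ _] := h2; rewrite we expR_lt1 in d1; rewrite (GE _ _ _ h2) expR_lt1 in d2.
have g10 : 0 < g1 by lra. have g20 : g2 < 0 by lra.
suff : f1 * g2 - f2 * g1 < 0 by move=> h; rewrite lt_eqF.
have h3 : f1 * g2 < - g2 * g1.
  by rewrite -subr_gt0 (_ : _ - _ = - g2 * (g1 + f1)); [rewrite mulr_gt0; lra | ring].
have h4 : - g2 * g1 < f2 * g1 by rewrite ltr_pM2r //; lra.
lra.
Qed.

(** * Complex embeddings and the sign tau *)

Lemma cembedding_rat (sigma : K -> R[i]) : is_cembedding m sigma ->
  forall c x, sigma (c *: x) = ratr c * sigma x.
Proof.
move=> [s1 sD sM]; pose psi c := sigma (c *: Kone).
have psiD c c' : psi (c + c') = psi c + psi c' by rewrite /psi scalerDl sD.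
have psiM c c' : psi (c * c') = psi c * psi c'.
  by rewrite /psi -sM KmulZl KmulC Kmul1 scalerA.
have psi1 : psi 1 = 1 by rewrite /psi scale1r.
have psi0 : psi 0 = 0 by apply: (addrI (psi 0)); rewrite -psiD !addr0.
have psin (n : nat) : psi n%:R = n%:R.
  by elim: n => [//|n IH]; rewrite -nat1r psiD psi1 IH nat1r.
have psiz (n : int) : psi n%:~R = n%:~R.
  case: n => n; first exact: psin.
  by apply: (addrI (psi n.+1%:R)); rewrite -psiD psin NegzE !rmorphN /= !subrr.
move=> c x.
have -> : sigma (c *: x) = psi c * sigma x by rewrite /psi -sM KmulZl KmulC Kmul1.
congr (_ * _); rewrite /ratr; apply: (mulIf (_ : (denq c)%:~R != 0)).
  by rewrite intr_eq0 denq_neq0.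
by rewrite -[in LHS](psiz (denq c)) -psiM -numqE psiz divfK // intr_eq0 denq_neq0.
Qed.

(** The polynomial (T - e x)(T - p)(T - q) has real roots and rational coefficients and annihilates
    x, so sigma x is one of its roots. *)
Lemma cembedding_real (sigma : K -> R[i]) : tau = 1 -> is_cembedding m sigma ->
  forall x, sigma x \is Num.real.
Proof.
move=> tauE sigP x; have [s1 sD sM] := sigP.
pose t := Ktr m x; pose t2 := (t ^+ 2 - Ktr m (x ** x)) / 2; pose n := Knorm m x.
pose p := Y x + Z x; pose q := Y x - Z x.
have tE : ratr t = e x + p + q by rewrite (qc_tr qc) /p /q; ring.
have t2E : ratr t2 = e x * p + e x * q + p * q.
  rewrite /t2 fmorph_div !(rmorph_nat, rmorphD, rmorphN, rmorphXn) /= tE (qc_tr qc).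
  by rewrite embRM (qcYM qc) tauE /p /q; field.
have nE : ratr n = e x * p * q by rewrite (qc_norm qc) tauE /p /q; ring.
move: p q tE t2E nE => p q tE t2E nE.
have cubic : x ** x ** x + t2 *: x = t *: (x ** x) + n *: Kone.
  by apply: embR_inj; rewrite !(embRD, embRZ, embRM) embR1 tE t2E nE; ring.
have toC c : ratr c = (real_complex R (ratr c)) :> R[i] by rewrite fmorph_rat.
have := congr1 sigma cubic.
rewrite !sD !(cembedding_rat sigP) !sM s1 !toC tE t2E nE !(rmorphD, rmorphM) /=.
move: (sigma x) => w hw.
have : (w - real_complex R (e x)) * (w - real_complex R p) * (w - real_complex R q) = 0.
  move/eqP: hw; rewrite -subr_eq0 => /eqP <-; ring.
move/eqP; rewrite !mulf_eq0 !subr_eq0 => /orP[/orP[]|] /eqP ->;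
  by apply/complex_realP; eexists.
Qed.

(** Y + i Z is such an embedding, and its imaginary part vanishes only on the rationals. *)
Lemma cembedding_nonreal : tau = -1 -> has_nonreal_embedding R m.
Proof.
move=> tauE; exists (fun x => Complex (Y x) (Z x)); split; first split.
- by rewrite (qcY1 qc) (qcZ1 qc).
- by move=> x y; rewrite (qcYD qc) (qcZD qc).
- move=> x y; rewrite (qcYM qc) (qcZM qc) tauE; apply/eqP.
  by rewrite eq_complex /= mulN1r mulNr eqxx /= addrC eqxx.
exists (Kbasis i1); rewrite complex_real; apply/eqP => /(qc_rat qc).
move/(congr1 (fun v : K => v ord0 i1)); rewrite /Kone /Kbasis !mxE /= mulr0 => /eqP.
by rewrite oner_eq0.
Qed.


(** * Discreteness of norms on the dual lattice *)

(** The matrix [M s] is an integer combination of the matrices of the dual basis, the rows of the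
    inverse Gram matrix. Clearing their denominators by d scales the determinant by d^3. *)
Lemma dual_lattice_norm : exists2 d : nat, (0 < d)%N &
  forall s, dual_lattice m s -> d%:R * Knorm m s \is a Num.int.
Proof.
pose dual l := row l (invmx trace_gram).
have [d d0 dP] := common_denominator
  (fun t : 'I_3 * 'I_3 * 'I_3 => M (dual t.1.1) t.1.2 t.2).
exists (d ^ 3)%N => [|s sdual]; first by rewrite expn_gt0 d0.
rewrite natrX -detZ; apply: det_int_num => k j; rewrite mxE.
have -> : M s = \sum_l pairing s l *: M (dual l).
  rewrite -[in LHS](mulmxK trace_gram_unit s) mulmx_sum_row.
  have MS (F : 'I_3 -> K) : M (\sum_l F l) = \sum_l M (F l).
    elim/big_rec2: _ => [|l x y _ <-]; last by rewrite mulmatD.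
    by rewrite -(scale0r 0) mulmatZ scale0r.
  by rewrite MS; apply: eq_bigr => l _; rewrite mulmatZ pairing_gram.
rewrite summxE mulr_sumr; apply: rpred_sum => l _; rewrite mxE mulrCA rpredM //.
  by have [z zE] := sdual l; rewrite /pairing zE intr_int.
exact: (dP (l, k, j)).
Qed.

Lemma int_ord (N : nat) (p : int) : `|p| <= N%:Z ->
  exists i : 'I_(N + N).+1, i%:Z - N%:Z = p.
Proof.
rewrite ler_norml => /andP[h1 h2].
have h : (`|(p + N%:Z)%R| < (N + N).+1)%N.
  by rewrite ltnS -lez_nat gez0_abs; [rewrite PoszD; lra|lra].
by exists (Ordinal h); rewrite /= gez0_abs; [ring | lra].
Qed.

Section Coordinates.
Variables (l1 l2 l3 l4 : R).
Hypothesis coord : forall s, let u1 := ratr (pairing s i0) * a1 - ratr (pairing s i1) in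
  let u2 := ratr (pairing s i0) * a2 - ratr (pairing s i2) in
  Y s = l1 * u1 + l2 * u2 /\ Z s = l3 * u1 + l4 * u2.

(** * Accumulation points *)

Definition conj_form (v : R * R) : R :=
  (l1 * v.1 + l2 * v.2) ^+ 2 - tau * (l3 * v.1 + l4 * v.2) ^+ 2.

(** At the approximation point of s, [conj_form] has the factor [|q|] with q = e s + 2 Y s; here the
    term 2 Y s is dropped. *)
Definition signed_norm s := `|e s| * (Y s ^+ 2 - tau * Z s ^+ 2).

(** Write Q for Y s ^ 2 - tau Z s ^ 2. Near v, the values |q| Q and |e s| Q differ by at most 2 |Y
    s| |Q|, where Y s is bounded and |Q| is a bounded quantity over |q|. It remains to avoid the
    finitely many nearby points with small q. *)
Lemma approx_near_signed_norm v eta : A_half a1 a2 v -> 0 < eta ->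
  exists s, [/\ dual_lattice m s, s != 0 & `|signed_norm s - conj_form v| < eta].
Proof.
move=> Av eta0; set c := conj_form v.
pose lam (w : R * R) := l1 * w.1 + l2 * w.2.
pose B := 2 * `|lam v| + 1; pose B' := B * (`|c| + eta).
have B0 : 0 < B by rewrite ltr_pwDr // mulr_ge0.
have B'0 : 0 <= B' by rewrite mulr_ge0 ?(ltW B0) // addr_ge0 // ltW.
(* For |q| > Mq the error, at most B' / |q|, is below eta / 2. *)
pose Mq := (Num.truncn (2 * B' / eta)).+1.
have MqE : 2 * B' / eta < Mq%:R by exact: truncnS_gt.
pose pt (q p1 p2 : int) : R * R := (Num.sqrt `|q%:~R| * (q%:~R * a1 - p1%:~R),
          Num.sqrt `|q%:~R| * (q%:~R * a2 - p2%:~R)).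
pose P := (Num.truncn (`|v.1| + `|v.2| + 1 + Mq%:R * (`|a1| + `|a2|))).+1.
have PE : `|v.1| + `|v.2| + 1 + Mq%:R * (`|a1| + `|a2|) < P%:R by exact: truncnS_gt.
(* This finite set contains all points within 1/2 of v in each coordinate with |q| <= Mq, since P
   then bounds p1 and p2. Without v it is closed, so some neighbourhood of v avoids it. *)
pose F := [set pt (t.1.1%:Z - Mq%:Z) (t.1.2%:Z - P%:Z) (t.2%:Z - P%:Z) |
   t in [set: 'I_(Mq + Mq).+1 * 'I_(P + P).+1 * 'I_(P + P).+1]].
have Fc : closed (F `\ v).
  have /accessible_finite_set_closed : accessible_space (R * R)%type.
    by apply: hausdorff_accessible; exact: norm_hausdorff.
  by apply; apply: finite_setD; apply: finite_image; exact: finite_finset.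
have fst_cont : continuous (fun w : R * R => w.1) by move=> w; exact: cvg_fst.
have snd_cont : continuous (fun w : R * R => w.2) by move=> w; exact: cvg_snd.
have lin_cont p q : continuous (fun w : R * R => p * w.1 + q * w.2).
  by move=> w; apply: cvgD; apply: cvgMl_tmp; [exact: fst_cont | exact: snd_cont].
have form_cont : continuous conj_form.
  move=> w; apply: cvgB; first by apply: cvgM; exact: lin_cont.
  by apply: cvgMl_tmp; apply: cvgM; exact: lin_cont.
have near_dist (f : R * R -> R) r : continuous f -> 0 < r ->
    \forall w \near v, `|f v - f w| < r.
  by move=> /(_ v)/cvgrPdist_lt; apply.
have U1 := near_dist _ (eta / 2) form_cont ltac:(by rewrite divr_gt0).
have U2 := near_dist _ (2^-1) (lin_cont l1 l2) ltac:(by rewrite invr_gt0).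
have U3 := near_dist _ (2^-1) fst_cont ltac:(by rewrite invr_gt0).
have U4 := near_dist _ (2^-1) snd_cont ltac:(by rewrite invr_gt0).
have U5 : nbhs v (~` (F `\ v)).
  by apply: open_nbhs_nbhs; split; [exact: closed_openC | move=> [_ /(_ erefl)]].
have [w [wv [q [q0 [p1 [p2 wE]]]]]] := Av _ (filterI U1 (filterI U2 (filterI U3 (filterI U4 U5)))).
move=> [hU1 [hU2 [hU3 [hU4 hU5]]]].
set r := Num.sqrt _ in wE.
have q1 : 1 <= `|q%:~R| :> R by rewrite norm_intr_ge1 ?intr_int ?intr_eq0.
have r2 : r ^+ 2 = `|q%:~R| by rewrite sqr_sqrtr.
have r1 : 1 <= r by rewrite -(sqrtr1 R) ler_sqrt // (lt_le_trans ltr01).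
have ql : (Mq%:Z < `|q|).
  rewrite ltNge; apply/negP => qle; apply: hU5; split; last by apply/eqP.
  have bnd p al (vi wi : R) : `|vi - wi| < 2^-1 -> wi = r * (q%:~R * al - p%:~R) ->
      `|vi| <= `|v.1| + `|v.2| -> `|al| <= `|a1| + `|a2| -> `|p| <= P%:Z.
    move=> vw wiE vi_le al_le; rewrite -(ler_int R) intr_norm.
    apply: le_trans (ltW PE).
    have h1 : `|q%:~R * al - p%:~R| <= `|wi|.
      by rewrite wiE normrM ler_peMl // ger0_norm // (le_trans ler01).
    have h2 : `|wi| <= `|vi| + 1.
      have := ler_normB vi (vi - wi); rewrite opprB addrC subrK => h.
      by apply: (le_trans h); rewrite lerD2l; lra.
    have h3 : `|q%:~R * al| <= Mq%:R * (`|a1| + `|a2|).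
      rewrite normrM ler_pM // -intr_norm; move: qle; rewrite -(ler_int R).
      by rewrite -pmulrn.
    have := ler_normB (q%:~R * al) (q%:~R * al - p%:~R).
    rewrite opprB addrC subrK => h; apply: (le_trans h); lra.
  have [i iE] := int_ord qle.
  have [|||j jE] := int_ord (bnd p1 a1 v.1 w.1 hU3 _ _ _).
  - by rewrite wE.
  - by rewrite lerDl.
  - by rewrite lerDl.
  have [|||k kE] := int_ord (bnd p2 a2 v.2 w.2 hU4 _ _ _).
  - by rewrite wE.
  - by rewrite lerDr.
  - by rewrite lerDr.
  by exists (i, j, k) => //=; rewrite iE jE kE wE.
have [s sE] := pairing_surj (\row_l [:: q%:~R; p1%:~R; p2%:~R]`_l).
have sdual : dual_lattice m s.
  move=> l; rewrite -/(pairing s l) sE mxE; move: l; apply: forall_ord3.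
  - by exists q.
  - by exists p1.
  - by exists p2.
have trs : Ktr m s = q%:~R by rewrite -pairingE sE mxE.
exists s; split => //.
  apply: contra_neq q0 => s0; apply/eqP; rewrite -(intr_eq0 rat) -trs s0.
  by rewrite -(scale0r 0) KtrZ mul0r.
have eY : q%:~R = e s + 2 * Y s by rewrite -(qc_tr qc) trs ratr_int.
have [YE ZE] := coord s; rewrite !sE !mxE /= !ratr_int in YE ZE.
have formE : conj_form w = `|q%:~R| * (Y s ^+ 2 - tau * Z s ^+ 2).
  by rewrite /conj_form wE /= -r2 YE ZE; ring.
have lamE : lam w = r * Y s by rewrite /lam wE YE /=; ring.
set Q := _ - _ in formE; have -> : signed_norm s = `|e s| * Q by [].
have q0' : 0 < `|q%:~R| :> R by exact: lt_le_trans ltr01 q1.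
have hlam : `|lam w| <= `|lam v| + 2^-1.
  have := ler_normB (lam v) (lam v - lam w); rewrite opprB addrC subrK => h.
  by apply: (le_trans h); rewrite lerD2l ltW.
have hform : `|conj_form w| <= `|c| + eta.
  have := ler_normB (conj_form v) (conj_form v - conj_form w).
  rewrite opprB addrC subrK => h; apply: (le_trans h); rewrite lerD2l.
  by apply: (le_trans (ltW hU1)); lra.
have Y2 : 2 * `|Y s| <= B.
  suff : `|Y s| <= `|lam w| by rewrite /B; lra.
  by rewrite lamE normrM ler_peMl // ger0_norm // (le_trans ler01).
have main : 2 * `|Y s| * `|Q| < eta / 2.
  rewrite -(ltr_pM2r q0'); apply: (@le_lt_trans _ _ B').
    rewrite -(mulrA (2 * `|Y s|)) /B'; apply: ler_pM; rewrite ?mulr_ge0 //.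
    by have -> : `|Q| * `|q%:~R| = `|conj_form w| by rewrite formE normrM normr_id mulrC.
  have ql' : Mq%:R < `|q%:~R| :> R by rewrite -intr_norm pmulrn ltr_int.
  have := lt_trans MqE ql'; rewrite ltr_pdivrMr //; lra.
have eq : `| `|e s| - `|q%:~R| | <= 2 * `|Y s|.
  apply: (le_trans (ler_dist_dist _ _)).
  by rewrite eY opprD addrA subrr sub0r normrN normrM ger0_norm.
have h1 : `| `|e s| * Q - conj_form w| < eta / 2.
  rewrite formE -mulrBl normrM; apply: le_lt_trans main.
  by rewrite ler_wpM2r.
have := ler_normD (`|e s| * Q - conj_form w) (conj_form w - c).
rewrite addrA subrK => h; apply: (le_lt_trans h).
by rewrite (distrC (conj_form w)); move: hU1; rewrite -/c; lra.
Qed.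

Lemma signed_normE s : (0 < e s -> signed_norm s = ratr (Knorm m s)) /\
  (e s <= 0 -> signed_norm s = - ratr (Knorm m s)).
Proof.
rewrite (qc_norm qc) /signed_norm; split => es; first by rewrite gtr0_norm.
by rewrite ler0_norm // mulNr.
Qed.

(** Signed norms on the dual lattice are integers divided by d. If one within 1 / (2 d) of the form
    is not exact, a strictly closer one differs from it by less than 1 / d, hence equals it, which
    is absurd. *)
Lemma A_half_signed_norm v : A_half a1 a2 v ->
  exists s, [/\ dual_lattice m s, s != 0 & conj_form v = signed_norm s].
Proof.
move=> Av; have [d d0 dP] := dual_lattice_norm.
have dR : 0 < d%:R :> R by rewrite ltr0n.
have int_sn s : dual_lattice m s -> exists z : int, d%:R * signed_norm s = z%:~R.
  move=> /dP/intrP[z /(congr1 (ratr : rat -> R))]; rewrite rmorphM rmorph_nat ratr_int /=.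
  move=> zE; have [h1 h2] := signed_normE s; have [es|es] := leP (e s) 0.
    by exists (- z); rewrite h2 // mulrN zE rmorphN.
  by exists z; rewrite h1.
have d2 : 0 < (2 * d%:R)^-1 :> R by rewrite invr_gt0 mulr_gt0.
have [s1 [s1d s10 h1]] := approx_near_signed_norm Av d2.
have [c1|c1] := eqVneq (conj_form v) (signed_norm s1); first by exists s1.
have [|s2 [s2d _ h2]] := @approx_near_signed_norm v
    (Num.min (2 * d%:R)^-1 `|signed_norm s1 - conj_form v|) Av.
  by rewrite lt_min d2 normr_gt0 subr_eq0 eq_sym.
move: h2; rewrite lt_min => /andP[h2 h3].
have [z1 e1] := int_sn _ s1d; have [z2 e2] := int_sn _ s2d.
suff z12 : z1 = z2.
  move: e1; rewrite z12 -e2 => /(mulfI (lt0r_neq0 dR)) e12.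
  by move: h3; rewrite e12 ltxx.
apply/eqP; rewrite -subr_eq0; apply: contraTT isT => z0.
have : 1 <= `|(z1 - z2)%:~R : R| by rewrite norm_intr_ge1 ?intr_int ?intr_eq0.
rewrite intrB -e1 -e2 -mulrBr normrM (gtr0_norm dR).
have -> : signed_norm s1 - signed_norm s2 = (signed_norm s1 - conj_form v)
   - (signed_norm s2 - conj_form v) by ring.
rewrite leNgt => /negP[]; rewrite mulrC -ltr_pdivlMr //.
apply: (le_lt_trans (ler_normB _ _)).
have -> : 1 / d%:R = (2 * d%:R)^-1 + (2 * d%:R)^-1 :> R by field; rewrite lt0r_neq0.
exact: ltrD.
Qed.

Lemma dual_latticeM u s : (forall k j, M u k j \is a Num.int) ->
  dual_lattice m s -> dual_lattice m (u ** s).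
Proof.
move=> uint sd l; apply/intrP.
have -> : (u ** s) ** Kbasis l = \sum_k M u k l *: (s ** Kbasis k).
  rewrite (KmulC u) -KmulA KmulC {1}(row_sum_delta (u ** Kbasis l)).
  elim/big_rec2: _ => [|k x y _ <-]; first by rewrite -(scale0r 0) KmulZl !scale0r.
  by rewrite KmulDl KmulZl (KmulC _ s) mulmat_col.
elim/big_rec: _ => [|k x _ xint]; first by rewrite -(scale0r 0) KtrZ mul0r.
rewrite KtrD KtrZ rpredD // rpredM //.
by have [z ->] := sd k; rewrite intr_int.
Qed.

(** In the coordinates (y, z), v is obtained from s, scaled to the same norm, by a norm-one element
    of angle t up to sign; units with angle near t and large g carry s to points near v. *)
Lemma A_half_of_signed_norm (C S : R -> R) (apm : angle_param tau C S)
  (units : forall t d B, 0 < d -> exists u f g, [/\ unit_at C S u f g, `|f - t| < d & B < g])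
  v s : l1 * l4 - l2 * l3 != 0 -> dual_lattice m s -> s != 0 ->
  conj_form v = signed_norm s -> A_half a1 a2 v.
Proof.
set D := _ - _ => D0 sd s0 vs.
have N0 : ratr (Knorm m s) != 0 :> R by rewrite fmorph_eq0 Knorm_eq0.
rewrite (qc_norm qc) mulf_eq0 negb_or in N0; have /andP[es0 Q0] := N0.
set Q := _ - _ in Q0.
pose rs := Num.sqrt `|e s|; have rs2 : rs ^+ 2 = `|e s| by rewrite sqr_sqrtr.
have ae0 : `|e s| != 0 by rewrite normr_eq0.
have c0 : `|e s| * Q != 0 by rewrite mulf_neq0.
pose y := l1 * v.1 + l2 * v.2; pose z := l3 * v.1 + l4 * v.2.
have yz : y ^+ 2 - tau * z ^+ 2 = `|e s| * Q by [].
pose Y0 := rs * Y s; pose Z0 := rs * Z s.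
have YZ0 : Y0 ^+ 2 - tau * Z0 ^+ 2 = `|e s| * Q by rewrite -rs2 /Y0 /Z0 /Q; ring.
(* The quotient of y + j z by Y0 + j Z0, two elements of the same nonzero norm. *)
have [sg [t [sg1 xE x'E]]] : exists sg t, [/\ sg = 1 \/ sg = -1,
    (y * Y0 - tau * z * Z0) / (`|e s| * Q) = sg * C t &
    (z * Y0 - y * Z0) / (`|e s| * Q) = sg * S t].
  apply: (ap_surj apm).
  have -> : 1 = (y ^+ 2 - tau * z ^+ 2) * (Y0 ^+ 2 - tau * Z0 ^+ 2) / (`|e s| * Q) ^+ 2.
    by rewrite yz YZ0; field; rewrite ae0 Q0.
  rewrite !expr_div_n [tau * (_ / _)]mulrA -mulrBl; congr (_ / _).
  by case: tau1 => ->; ring.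
have yE : y = sg * (Y0 * C t + tau * Z0 * S t).
  have -> : sg * (Y0 * C t + tau * Z0 * S t) =
    Y0 * (sg * C t) + tau * Z0 * (sg * S t) by ring.
  rewrite -xE -x'E.
  have -> : Y0 * ((y * Y0 - tau * z * Z0) / (`|e s| * Q)) +
     tau * Z0 * ((z * Y0 - y * Z0) / (`|e s| * Q)) =
     y * (Y0 ^+ 2 - tau * Z0 ^+ 2) / (`|e s| * Q) by field; rewrite ae0 Q0.
  by rewrite YZ0 mulfK.
have zE : z = sg * (Y0 * S t + Z0 * C t).
  have -> : sg * (Y0 * S t + Z0 * C t) = Y0 * (sg * S t) + Z0 * (sg * C t) by ring.
  rewrite -xE -x'E.
  have -> : Y0 * ((z * Y0 - y * Z0) / (`|e s| * Q)) +
     Z0 * ((y * Y0 - tau * z * Z0) / (`|e s| * Q)) =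
     z * (Y0 ^+ 2 - tau * Z0 ^+ 2) / (`|e s| * Q) by field; rewrite ae0 Q0.
  by rewrite YZ0 mulfK.
(* [Psi (exp (-3 g), f)] is the approximation point of [sg * u * s] for a unit [u]
   of angle [f] and size [2 g]; as [g] tends to infinity it tends to [Psi (0, f)]. *)
pose ys f := Y s * C f + tau * Z s * S f; pose zs f := Y s * S f + Z s * C f.
pose kap (w : R * R) := e s + 2 * w.1 * ys w.2.
pose Psi1 (w : R * R) := Num.sqrt `|kap w| * (sg * ((l4 * ys w.2 - l2 * zs w.2) / D)).
pose Psi2 (w : R * R) := Num.sqrt `|kap w| * (sg * ((l1 * zs w.2 - l3 * ys w.2) / D)).
have ys_cont : continuous ys.
  by move=> f; apply: cvgD; apply: cvgMl_tmp; [apply: (apC_cont apm) | apply: (apS_cont apm)].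
have zs_cont : continuous zs.
  by move=> f; apply: cvgD; apply: cvgMl_tmp; [apply: (apS_cont apm) | apply: (apC_cont apm)].
have snd_cont (F : R -> R) : continuous F -> continuous (fun w : R * R => F w.2).
  by move=> Fc w; apply: (@cvg_comp _ _ _ snd F); [exact: cvg_snd | exact: Fc].
have kap_cont : continuous kap.
  move=> w; apply: cvgD; first exact: cvg_cst.
  by apply: cvgM; [apply: cvgMl_tmp; exact: cvg_fst | exact: snd_cont].
have sk_cont : continuous (fun w : R * R => Num.sqrt `|kap w|).
  move=> w; apply: (@cvg_comp _ _ _ (fun w => `|kap w|) Num.sqrt).
    by apply: cvg_norm; exact: kap_cont.
  exact: sqrt_continuous.
have Psi1_cont : continuous Psi1.
  move=> w; apply: cvgM; first exact: sk_cont.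
  apply: cvgMl_tmp; apply: cvgMr_tmp; apply: (@snd_cont (fun f => l4 * ys f - l2 * zs f)) => f.
  by apply: cvgB; apply: cvgMl_tmp; [exact: ys_cont | exact: zs_cont].
have Psi2_cont : continuous Psi2.
  move=> w; apply: cvgM; first exact: sk_cont.
  apply: cvgMl_tmp; apply: cvgMr_tmp; apply: (@snd_cont (fun f => l1 * zs f - l3 * ys f)) => f.
  by apply: cvgB; apply: cvgMl_tmp; [exact: zs_cont | exact: ys_cont].
pose Psi w := (Psi1 w, Psi2 w).
have Psi_cont : continuous Psi by move=> w; exact: (cvg_pair (Psi1_cont w) (Psi2_cont w)).
have sq0 f : kap (0, f) = e s by rewrite /kap mulr0 mul0r addr0.
have Psi0 : Psi (0, t) = v.
  rewrite /Psi /Psi1 /Psi2 !sq0 -/rs /=; rewrite [RHS]surjective_pairing; congr (_, _).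
    have -> : v.1 = (l4 * y - l2 * z) / D by rewrite /y /z /D; field.
    by rewrite yE zE /Y0 /Z0 /ys /zs; field.
  have -> : v.2 = (l1 * z - l3 * y) / D by rewrite /y /z /D; field.
  by rewrite yE zE /Y0 /Z0 /ys /zs; field.
move=> U Uv.
have : nbhs (0, t) (Psi @^-1` U) by apply: Psi_cont; rewrite Psi0.
move=> /nbhs_ballP[d1 /= d10 hd1].
(* Aiming at t could return v itself, which a limit point excludes. The nearby angle t' gives
   another point because [S] has no zero between 0 and 1. *)
pose t' := t + Num.min (d1 / 2) 2^-1.
have tt' : 0 < t' - t < d1.
  rewrite /t' addrAC subrr add0r lt_min invr_gt0 ltr0n divr_gt0 //= gt_min.
  by rewrite ltr_pdivrMr // ltr_pMr // ltr1n.
have tt1 : 0 < t' - t < 1.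
  case/andP: tt' => -> _; rewrite /t' addrAC subrr add0r gt_min orbC invf_lt1 // ?ltr1n //.
have Psi't : Psi (0, t') != v.
  rewrite -Psi0; apply/eqP => -[]; rewrite /Psi1 /Psi2 !sq0 -/rs /= => E1 E2.
  have rs0 : rs != 0 by rewrite sqrtr_eq0 -ltNge normr_gt0.
  have sg0 : sg != 0 by case: sg1 => ->; rewrite ?oppr_eq0 oner_eq0.
  have Ey : ys t' = ys t.
    apply: (mulfI sg0); apply: (mulfI rs0).
    transitivity (l1 * (rs * (sg * ((l4 * ys t' - l2 * zs t') / D)))
        + l2 * (rs * (sg * ((l1 * zs t' - l3 * ys t') / D)))).
      by rewrite /D; field.
    by rewrite E1 E2 /D; field.
  have Ez : zs t' = zs t.
    apply: (mulfI sg0); apply: (mulfI rs0).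
    transitivity (l3 * (rs * (sg * ((l4 * ys t' - l2 * zs t') / D)))
        + l4 * (rs * (sg * ((l1 * zs t' - l3 * ys t') / D)))).
      by rewrite /D; field.
    by rewrite E1 E2 /D; field.
  have EC : C t' = C t.
    apply: (mulfI Q0); transitivity (Y s * ys t' - tau * Z s * zs t').
      by rewrite /Q /ys /zs; ring.
    by rewrite Ey Ez /Q /ys /zs; ring.
  have ES : S t' = S t.
    apply: (mulfI Q0); transitivity (Y s * zs t' - Z s * ys t').
      by rewrite /Q /ys /zs; ring.
    by rewrite Ey Ez /Q /ys /zs; ring.
  have /negP[] := apS_neq0 apm tt1.
  by rewrite (apSD apm) EC ES -(apSD apm) subrr (apS0 apm).
(* A nonzero [kap] will make q nonzero. *)
have : nbhs (0, t') (Psi @^-1` [set~ v] `&` kap @^-1` [set~ 0]).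
  apply: filterI; apply: open_nbhs_nbhs; split.
  - apply: open_comp; first by move=> ? _; exact: Psi_cont.
    rewrite openC; apply: accessible_closed_set1; apply: hausdorff_accessible.
    exact: norm_hausdorff.
  - by apply/eqP.
  - apply: open_comp; first by move=> ? _; exact: kap_cont.
    rewrite openC; apply: accessible_closed_set1; apply: hausdorff_accessible.
    exact: norm_hausdorff.
  - by rewrite /= sq0; apply/eqP.
move=> /nbhs_ballP[d2 /= d20 hd2].
case/andP: (tt') => t't t'd.
pose d3 := Num.min d2 (d1 - (t' - t)).
have d30 : 0 < d3 by rewrite lt_min d20 subr_gt0.
(* The bound g > |ln d3| gives exp (-3 g) < d3. *)
have [u [f [g [[uint ue uY uZ] uf ug]]]] := units t' d3 `|ln d3| d30.
pose rho := expR (- (3 * g)); have rho0 : 0 < rho by exact: expR_gt0.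
have rhod : rho < d3.
  rewrite -[ltRHS](lnK (_ : d3 \in Num.pos)) ?posrE // ltr_expR.
  have := ler_norm (- ln d3); rewrite normrN; have := normr_ge0 (ln d3); lra.
have d3E : d3 <= d2 /\ d3 <= d1 - (t' - t) by rewrite !ge_min !lexx orbT.
have hU : U (Psi (rho, f)).
  apply: hd1; split; rewrite /ball /=.
    by rewrite sub0r normrN gtr0_norm //; lra.
  by move: uf; rewrite !ltr_norml => /andP[? ?]; apply/andP; split; lra.
have [hv hk] : (Psi @^-1` [set~ v] `&` kap @^-1` [set~ 0]) (rho, f).
  apply: hd2; split; rewrite /ball /=.
    by rewrite sub0r normrN gtr0_norm //; lra.
  by rewrite distrC; lra.
exists (Psi (rho, f)); split => //; first by apply/eqP.
(* The sign becomes a rational scalar so that it can multiply an element of K. *)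
have [r rE rint] : exists2 r : rat, ratr r = sg & r \is a Num.int.
  by case: sg1 => ->; [exists 1 | exists (-1)]; rewrite ?rmorphN1 ?rmorph1.
pose s' := r *: (u ** s).
have s'd : dual_lattice m s'.
  move=> l; have [n nE] := dual_latticeM uint sd l.
  by apply/intrP; rewrite /s' KmulZl KtrZ nE rpredM ?intr_int.
have es' : e s' = sg * (expR (2 * g) * e s) by rewrite /s' embRZ embRM rE ue.
have Ys' : Y s' = sg * (expR (- g) * ys f).
  by rewrite /s' (qcYZ qc) (qcYM qc) rE uY uZ /ys; ring.
have Zs' : Z s' = sg * (expR (- g) * zs f).
  by rewrite /s' (qcZZ qc) (qcZM qc) rE uY uZ /zs; ring.
have eg : expR (- g) = expR (2 * g) * rho by rewrite /rho -expRD; congr expR; ring.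
have eg2 : expR (2 * g) = expR g ^+ 2 by rewrite expr2 -expRD; congr expR; ring.
have egN : expR g * expR (- g) = 1 by rewrite -expRD subrr expR0.
have [q qE] := s'd i0; have [p1 p1E] := s'd i1; have [p2 p2E] := s'd i2.
(* As q = e s' + 2 Y s', it has a factor exp (2 g), whose square root cancels the factor exp (-g) of
   Y s' and Z s'. *)
have qR : q%:~R = sg * (expR (2 * g) * kap (rho, f)).
  rewrite -(ratr_int R q) -qE -/(pairing s' i0) pairingE (qc_tr qc) es' Ys' eg.
  by rewrite /kap /=; ring.
have nsg : `|sg| = 1 by case: sg1 => ->; rewrite ?normrN normr1.
have sqE : Num.sqrt `|q%:~R| = expR g * Num.sqrt `|kap (rho, f)|.
  rewrite qR !normrM nsg mul1r eg2 normrX sqrtrM ?exprn_ge0 // sqrtr_sqr normr_id.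
  by rewrite (gtr0_norm (expR_gt0 g)).
exists q; split.
  apply: contra_not_neq hk => q0; move: qR; rewrite q0 => /esym/eqP.
  rewrite !mulf_eq0 -normr_eq0 nsg oner_eq0 gt_eqF ?expR_gt0 //= => /eqP.
  by [].
exists p1, p2; have [YE ZE] := coord s'.
rewrite /pairing qE p1E p2E !ratr_int in YE ZE.
set U1 := _ - _ in YE ZE; set U2 := _ - _ in YE ZE.
have U1E : U1 = (l4 * Y s' - l2 * Z s') / D by rewrite YE ZE /D; field.
have U2E : U2 = (l1 * Z s' - l3 * Y s') / D by rewrite YE ZE /D; field.
rewrite /Psi /Psi1 /Psi2 -/U1 -/U2 U1E U2E Ys' Zs' sqE /=; congr (_, _).
  by rewrite -[LHS]mul1r -egN; field.
by rewrite -[LHS]mul1r -egN; field.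
Qed.

Lemma conj_form_scale r w : conj_form (r * w.1, r * w.2) = r ^+ 2 * conj_form w.
Proof. by rewrite /conj_form /=; ring. Qed.

Lemma signed_norm_sg s :
  signed_norm s = Num.sg (Y s ^+ 2 - tau * Z s ^+ 2) * `|ratr (Knorm m s)|.
Proof. by rewrite (qc_norm qc) normrM mulrCA -numEsg. Qed.

(** Dilation by the square root of |N s| turns the level set of [conj_form] at a sign into its level
    set at the signed norm. The family [CC] serves both the ellipse and the two conjugate
    hyperbolas. *)
Lemma A_half_bigcup (C S : R -> R) (CC : K -> set (R * R)) :
  angle_param tau C S ->
  (forall t d B, 0 < d -> exists u f g, [/\ unit_at C S u f g, `|f - t| < d & B < g]) ->
  l1 * l4 - l2 * l3 != 0 ->
  (forall s, s != 0 -> CC s = [set w | conj_form w = Num.sg (Y s ^+ 2 - tau * Z s ^+ 2)]) ->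
  A_half a1 a2 = \bigcup_(s in dual_lattice m `\ 0)
    dilate (Num.sqrt `|ratr (Knorm m s) : R|) (CC s).
Proof.
move=> apm units l0 CCE; apply/seteqP; split => v.
  move=> /A_half_signed_norm[s [sd s0 vs]]; exists s.
    by split => //; apply/eqP.
  rewrite CCE //; set r := Num.sqrt _.
  have r0 : r != 0 by rewrite sqrtr_eq0 -ltNge normr_gt0 fmorph_eq0 Knorm_eq0.
  have r2 : r ^+ 2 = `|ratr (Knorm m s)| by rewrite sqr_sqrtr.
  exists (r^-1 * v.1, r^-1 * v.2) => /=; last by rewrite !mulVKf // -surjective_pairing.
  by rewrite conj_form_scale vs signed_norm_sg -r2; field.
move=> [s [sd /eqP s0]]; rewrite CCE // => -[w wE <-].
apply: (A_half_of_signed_norm apm units l0 sd s0).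
by rewrite conj_form_scale wE signed_norm_sg sqr_sqrtr // mulrC.
Qed.

End Coordinates.
End Conjugates.
End CubicField.

(** * The ellipse and the hyperbolas *)

Theorem theorem5 (R : realType) (a1 a2 : R)
  (m : 'I_3 -> 'I_3 -> 'I_3 -> rat)
  (* {1, a1, a2} is linearly independent over Q *)
  (indep : forall x : 'rV[rat]_3, embR a1 a2 x = 0 -> x = 0)
  (* the Q-span is closed under multiplication, with multiplication table m *)
  (table : forall i j : 'I_3,
     basisK a1 a2 i * basisK a1 a2 j = \sum_(k < 3) ratr (m i j k) * basisK a1 a2 k) :
  (has_nonreal_embedding R m ->
     exists CK : set (R * R), is_ellipse CK /\
       A_half a1 a2 =
         \bigcup_(s in dual_lattice m `\ 0)
            dilate (Num.sqrt `|ratr (Knorm m s) : R|) CK)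
  /\
  (totally_real R m ->
     exists a b c : R, 4 * a * c < b ^+ 2 /\
     exists l : 'rV[rat]_3 -> (R * R -> R * R),
       (forall s, s \in dual_lattice m `\ 0 ->
          l s = id \/ (is_linear2 (l s) /\
                       l s @` hyperbola a b c = conj_hyperbola a b c)) /\
       A_half a1 a2 =
         \bigcup_(s in dual_lattice m `\ 0)
            dilate (Num.sqrt `|ratr (Knorm m s) : R|) (l s @` hyperbola a b c)).
Proof.
have [tau [Y [Z [tau1 qc]]]] := quadratic_conj_exists indep table.
have [l1 [l2 [l3 [l4 [l0 coord]]]]] := pairing_coord indep table tau1 qc.
pose form := conj_form tau l1 l2 l3 l4.
have Q0 s : s != 0 -> Y s ^+ 2 - tau * Z s ^+ 2 != 0.
  rewrite -(Knorm_eq0 indep table) -(fmorph_eq0 (ratr : {rmorphism rat -> R})) /=.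
  by rewrite (qc_norm qc) mulf_eq0 negb_or => /andP[].
split.
  move=> [sigma [sigP [x /negP xreal]]].
  have tauE : tau = -1.
    by case: tau1 => // tauE; case: xreal; exact: (cembedding_real indep table qc tauE sigP).
  exists [set v | form v = 1]; split.
    (* The coefficients of [form] at tau = -1, with centre at the origin. *)
    exists (l1 ^+ 2 + l3 ^+ 2), (2 * (l1 * l2 + l3 * l4)), (l2 ^+ 2 + l4 ^+ 2), 0, 0.
    have D0 : 0 < (l1 * l4 - l2 * l3) ^+ 2 by rewrite lt0r sqrf_eq0 l0 sqr_ge0.
    split; last split.
    - rewrite lt0r addr_ge0 ?sqr_ge0 // andbT paddr_eq0 ?sqr_ge0 // !sqrf_eq0.
      apply: contra l0 => /andP[/eqP -> /eqP ->]; by rewrite mul0r mulr0 subrr.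
    - rewrite -subr_gt0 (_ : _ - _ = 4 * (l1 * l4 - l2 * l3) ^+ 2); last by ring.
      by rewrite mulr_gt0.
    - apply/seteqP; split => v /= vE; rewrite -[RHS]vE /form /conj_form /qform /= !subr0 tauE; ring.
  have apm : angle_param tau cos sin by rewrite tauE; exact: angle_param_circle.
  apply: (A_half_bigcup indep table tau1 qc coord apm) => //.
    exact: (units_dense_complex indep table qc tauE).
  move=> s /Q0 q0; rewrite gtr0_sg // lt0r q0 tauE mulN1r opprK.
  by rewrite addr_ge0 ?sqr_ge0.
move=> real.
have tauE : tau = 1.
  case: tau1 => // /(cembedding_nonreal qc)[sigma [sigP [x /negP[]]]].
  exact: real.
have D0 : 0 < (l1 * l4 - l2 * l3) ^+ 2 by rewrite lt0r sqrf_eq0 l0 sqr_ge0.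
pose a := l1 ^+ 2 - l3 ^+ 2; pose b := 2 * (l1 * l2 - l3 * l4); pose c := l2 ^+ 2 - l4 ^+ 2.
have formE v : qform a b c v = form v.
  by rewrite /form /conj_form /qform tauE /a /b /c; ring.
exists a, b, c; split.
  rewrite -subr_gt0 (_ : _ - _ = 4 * (l1 * l4 - l2 * l3) ^+ 2); last by rewrite /a /b /c; ring.
  by rewrite mulr_gt0.
set D := _ - _ in l0 D0.
(* J exchanges the coordinates y and z, which changes the sign of y^2 - z^2. *)
pose J (v : R * R) : R * R := let y := l1 * v.1 + l2 * v.2 in let z := l3 * v.1 + l4 * v.2 in
  ((l4 * z - l2 * y) / D, (l1 * y - l3 * z) / D).
have J1 v : l1 * (J v).1 + l2 * (J v).2 = l3 * v.1 + l4 * v.2 by rewrite /J /= /D; field.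
have J2 v : l3 * (J v).1 + l4 * (J v).2 = l1 * v.1 + l2 * v.2 by rewrite /J /= /D; field.
have formJ v : form (J v) = - form v.
  by rewrite /form /conj_form J1 J2 tauE; ring.
have JJ v : J (J v) = v.
  by rewrite {1}/J J1 J2 [RHS]surjective_pairing; congr (_, _); rewrite /D; field.
have J_hyp : J @` hyperbola a b c = conj_hyperbola a b c.
  apply/seteqP; split => [_ [v + <-]|v].
    by rewrite /hyperbola /conj_hyperbola /= !formE formJ => ->.
  rewrite /conj_hyperbola /= formE => vE; exists (J v); last exact: JJ.
  by rewrite /hyperbola /= formE formJ vE opprK.
have J_lin : is_linear2 J.
  exists ((l4 * l3 - l2 * l1) / D), ((l4 ^+ 2 - l2 ^+ 2) / D), ((l1 ^+ 2 - l3 ^+ 2) / D),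
    ((l1 * l2 - l3 * l4) / D) => v.
  by rewrite /J /=; congr (_, _); field.
exists (fun s => if 0 < Y s ^+ 2 - tau * Z s ^+ 2 then id else J); split.
  by move=> s _; case: ifP => _; [left | right].
apply: (A_half_bigcup indep table tau1 qc coord _
  (units_dense_real indep table qc tauE)) => //.
  by rewrite tauE; exact: angle_param_hyperbola.
move=> s /Q0 q0; case: ifP => [q1|/negbT].
  by rewrite image_id gtr0_sg //; apply/seteqP; split => v; rewrite /hyperbola /= formE.
rewrite -leNgt => q1; rewrite J_hyp ltr0_sg ?lt_neqAle ?q0 //.
by apply/seteqP; split => v; rewrite /conj_hyperbola /= formE.
Qed.
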